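(* Let $P$ be a right LCM semigroup with trivial group of units, and let $\beta$ be a $P$-action by $*$-automorphisms on a unital $\mathrm{C}^*$-algebra $\mathcal{A}$. Let $\phi:\mathcal{A}\to\mathcal{B}(\mathcal{H})$ be a unital completely positive map and let $T:P\to\mathcal{B}(\mathcal{H})$ be a contractive representation of $P$. The following are equivalent: (1) There exist a $*$-homomorphism $\pi:\mathcal{A}\to\mathcal{B}(\mathcal{K})$ and an isometric representation $V:P\to\mathcal{B}(\mathcal{K})$ on a Hilbert space $\mathcal{K}\supset\mathcal{H}$ such that for all $a,b\in\mathcal{A}$ and $p,q\in P$: if $pP\cap qP=rP$, then \[V(p)\pi(\beta_p^{-1}(a))V(p)^*\,V(q)\pi(\beta_q^{-1}(b))V(q)^*=V(r)\pi(\beta_r^{-1}(ab))V(r)^*;\] and if $pP\cap qP=\emptyset$, then $V(p)$ and $V(q)$ have orthogonal ranges. Moreover, $\pi$ and $V$ are dilations of $\phi$ and $T$, respectively, and $\mathcal{H}$ is co-invariant for $V$. (2) For each finite $F\subset P$, the map $\phi_F:\mathcal{A}\to\mathcal{B}(\mathcal{H})$ defined by \[\phi_F(a)=\sum_{U\subseteq F}(-1)^{|U|}T(s_U)\phi(\beta_{s_U}^{-1}(a))T(s_U)^*\] is completely positive.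
   Context: $P$ is a cancellative semigroup with identity $e$ which is right LCM (for all $p,q\in P$ either $pP\cap qP=\emptyset$ or $pP\cap qP=rP$ for some $r\in P$) and whose only invertible element is $e$, so such $r$ is unique. $\beta$ being a $P$-action by $*$-automorphisms means each $\beta_p$ is a $*$-automorphism of $\mathcal{A}$, $\beta_p\circ\beta_q=\beta_{pq}$, $\beta_e=\mathrm{id}$. A contractive (isometric) representation of $P$ is a unital semigroup homomorphism into $\mathcal{B}(\mathcal{H})$ with contractive (isometric) values. No covariance relation between $\phi$ and $T$ is assumed. For finite $U\subset P$, $s_U\in P$ is the unique element with $s_UP=\bigcap_{p\in U}pP$ when this intersection is non-empty ($s_\emptyset=e$); if $\bigcap_{p\in U}pP=\emptyset$, then $s_U=\infty$ and $T(\infty)=0$, i.e. the corresponding term in the sum is $0$. $\pi$ dilates $\phi$ if $\phi(a)=P_{\mathcal{H}}\pi(a)|_{\mathcal{H}}$ for all $a\in\mathcal{A}$; $V$ dilates $T$ if $T(p)=P_{\mathcal{H}}V(p)|_{\mathcal{H}}$ for all $p\in P$; $\mathcal{H}$ is co-invariant for $V$ if $V(p)^*\mathcal{H}\subseteq\mathcal{H}$ for all $p$. *)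

(* Defs.v *)
From HB Require Import structures.
From mathcomp Require Import all_boot all_order all_algebra.
From mathcomp Require Import sesquilinear complex finmap.
From mathcomp Require Import boolp classical_sets functions reals.
From mathcomp Require Import topology normedtype.

Set Implicit Arguments.
Unset Strict Implicit.
Unset Printing Implicit Defensive.

Import Order.TTheory GRing.Theory Num.Theory.
Import numFieldNormedType.Exports.

Local Open Scope classical_set_scope.
Local Open Scope ring_scope.
Local Open Scope complex_scope.

(* Complex Hilbert spaces. The inner product is linear in its first argument
   and conjugate-linear in the second; it induces the norm. *)
HB.mixin Record CompleteNormedModule_isHilbert (R : realType) (H : Type)
    & CompleteNormedModule R[i] H := {
  dotp : {dot H for @Num.conj R[i]} ;
  norm_dotp : forall x : H, `|x| ^+ 2 = dotp x x
}.

#[short(type="hilbertType")]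
HB.structure Definition Hilbert (R : realType) :=
  {H of CompleteNormedModule R[i] H & CompleteNormedModule_isHilbert R H}.

(* Unital C*-algebras; 1 = 0 is not excluded. The library has no structure that
   is both a ring and a normed module, and Hierarchy Builder does not allow
   joining the two a posteriori, so the product is part of the mixin and the
   ring structure is an instance on the resulting type. *)
HB.mixin Record CompleteNormedModule_isCStar (R : realType) (A : Type)
    & CompleteNormedModule R[i] A := {
  cstar_one : A ;
  cstar_mul : A -> A -> A ;
  star : A -> A ;
  cstar_mulA : associative cstar_mul ;
  cstar_mul1l : left_id cstar_one cstar_mul ;
  cstar_mul1r : right_id cstar_one cstar_mul ;
  cstar_mulDl : left_distributive cstar_mul +%R ;
  cstar_mulDr : right_distributive cstar_mul +%R ;
  cstar_scalerAl : forall (c : R[i]) (a b : A),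
    c *: cstar_mul a b = cstar_mul (c *: a) b ;
  cstar_scalerAr : forall (c : R[i]) (a b : A),
    c *: cstar_mul a b = cstar_mul a (c *: b) ;
  cstar_normM : forall a b : A, `|cstar_mul a b| <= `|a| * `|b| ;
  starK : involutive star ;
  starD : {morph star : a b / a + b} ;
  starZ : forall (c : R[i]) (a : A), star (c *: a) = Num.conj c *: star a ;
  starM : forall a b : A, star (cstar_mul a b) = cstar_mul (star b) (star a) ;
  cstar_norm_star : forall a : A, `|cstar_mul (star a) a| = `|a| ^+ 2
}.

#[short(type="cstarType")]
HB.structure Definition CStar (R : realType) :=
  {A of CompleteNormedModule R[i] A & CompleteNormedModule_isCStar R A}.

#[non_forgetful_inheritance]
HB.instance Definition _ (R : realType) (A : cstarType R) :=
  GRing.Zmodule_isPzRing.Build A (@cstar_mulA R A) (@cstar_mul1l R A)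
    (@cstar_mul1r R A) (@cstar_mulDl R A) (@cstar_mulDr R A).

Section Operators.
Variable R : realType.
Implicit Types H K : hilbertType R.

(* Operators are plain functions, which the library makes an R[i]-module under
   pointwise operations; B(H, K) is the set of those satisfying bounded_op. *)
Definition bounded_op H K (S : H -> K) : Prop := linear S /\ continuous S.

(* For S in B(H, K), Riesz representation gives exactly one adjoint, so the
   default value 0 is never used. *)
Definition adj H K (S : H -> K) : K -> H :=
  xget (0 : K -> H) [set S' | forall x y, dotp (S x) y = dotp x (S' y)].

(* An operator on H^n, given by its n x n matrix of operators on H, is
   positive. *)
Definition op_matrix_pos H n (S : 'I_n -> 'I_n -> H -> H) : Prop :=
  forall h : 'I_n -> H, 0 <= \sum_i \sum_j dotp (S i j (h j)) (h i).

(* The positive elements of the C*-algebra M_n(A) are those of the form b^* b. *)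
Definition cstar_matrix_pos (A : cstarType R) n (a : 'M[A]_n) : Prop :=
  exists b : 'M[A]_n, a = (map_mx star b)^T *m b.

Definition completely_positive (A : cstarType R) H (phi : A -> H -> H) : Prop :=
  [/\ forall a, bounded_op (phi a), linear phi &
      forall n (a : 'M[A]_n),
        cstar_matrix_pos a -> op_matrix_pos (fun i j => phi (a i j))].

Definition star_hom (A : cstarType R) H (pi : A -> H -> H) : Prop :=
  [/\ forall a, bounded_op (pi a), linear pi,
      forall a b, pi (a * b) = pi a \o pi b &
      forall a, pi (star a) = adj (pi a)].

Definition star_automorphism (A : cstarType R) (f : A -> A) : Prop :=
  [/\ bijective f, linear f, {morph f : a b / a * b} & {morph f : a / star a}].

(* Here J : H -> K is the inclusion of H into a larger Hilbert space K: a linear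
   isometry identifying H with J(H). *)
Definition inclusion H K (J : H -> K) : Prop :=
  linear J /\ forall x, `|J x| = `|x|.

(* J h is the orthogonal projection P_H k of k on J(H). *)
Definition orthoproj H K (J : H -> K) (k : K) (h : H) : Prop :=
  forall x, dotp (k - J h) (J x) = 0.

(* T = P_H S |_H *)
Definition compresses H K (J : H -> K) (S : K -> K) (T : H -> H) : Prop :=
  forall h, orthoproj J (S (J h)) (T h).

End Operators.

Section Semigroups.
Variable P : monoidType.

Definition right_ideal (p : P) : set P := range (fun x => (p * x)%g).

Definition cancellative : Prop :=
  (forall p, injective (fun x : P => (p * x)%g)) /\
  (forall p, injective (fun x : P => (x * p)%g)).

Definition right_LCM : Prop := forall p q,
  right_ideal p `&` right_ideal q = set0 \/
  exists r, right_ideal p `&` right_ideal q = right_ideal r.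

Definition trivial_units : Prop :=
  forall u v : P, (u * v = 1)%g -> (v * u = 1)%g -> u = 1%g.

(* s_U, with None for infinity *)
Definition lcm_set (U : {fset P}) : option P :=
  let I := \bigcap_(p in [set` U]) right_ideal p in
  if `[< I = set0 >] then None else Some (xget 1%g [set s | right_ideal s = I]).

Variable R : realType.
Implicit Types H : hilbertType R.

Definition action_by_automorphisms (A : cstarType R) (beta : P -> A -> A) :=
  [/\ forall p, star_automorphism (beta p),
      forall p q, beta p \o beta q = beta (p * q)%g & beta 1%g = id].

Definition inv_action (A : cstarType R) (beta : P -> A -> A) (p : P) : A -> A :=
  'pinv_(fun=> 0) [set: A] (beta p).

Definition representation H (T : P -> H -> H) : Prop :=
  [/\ forall p, bounded_op (T p), T 1%g = id &
      forall p q, T (p * q)%g = T p \o T q].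

Definition contractive_representation H (T : P -> H -> H) : Prop :=
  representation T /\ forall p x, `|T p x| <= `|x|.

Definition isometric_representation H (V : P -> H -> H) : Prop :=
  representation V /\ forall p x, `|V p x| = `|x|.

(* S(p) rho(beta_p^{-1}(a)) S(p)^* *)
Definition conj_op (A : cstarType R) H (beta : P -> A -> A) (rho : A -> H -> H)
    (S : P -> H -> H) (p : P) (a : A) : H -> H :=
  S p \o rho (inv_action beta p a) \o adj (S p).

Definition phi_F (A : cstarType R) H (beta : P -> A -> A) (phi : A -> H -> H)
    (T : P -> H -> H) (F : {fset P}) (a : A) : H -> H :=
  \sum_(U <- fpowerset F) (-1 : R[i]) ^+ #|` U|%fset *:
    (if lcm_set U is Some s then conj_op beta phi T s a else 0).

End Semigroups.

(* Main.v *)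
Require Import Defs.
From HB Require Import structures.
From mathcomp Require Import all_boot all_order all_algebra.
From mathcomp Require Import sesquilinear complex finmap.
From mathcomp Require Import boolp classical_sets functions reals.
From mathcomp Require Import interval_inference topology normedtype.
From mathcomp Require Import ring lra.
Import Order.TTheory GRing.Theory Num.Theory.
Import numFieldNormedType.Exports.
Local Open Scope classical_set_scope.
Local Open Scope ring_scope.
Set Implicit Arguments.
Unset Strict Implicit.
Unset Printing Implicit Defensive.

(** The theorem is a dilation theorem in the style of Naimark and Stinespring.

    Suppose that a dilation (pi, V) is given, and put
    E_p(a) = V(p) pi(beta_p^-1(a)) V(p)^* . The covariance relations say that
    E_p(a) E_q(b) is E_r(ab) when pP and qP meet in rP, and 0 when they are
    disjoint. So the E_p multiply as the right ideals pP intersect, and for a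
    finite set F the alternating sum M(a) of the E_{s_U}(a), U a subset of F,
    is again multiplicative ([altsum_conj_mul]) and *-preserving
    ([altsum_conj_adj]); for unital pi, M(a) is pi(a) times the product over p in F of
    the commuting projections 1 - V(p) V(p)^* . Since J(H) is co-invariant,
    phi_F is the compression of the completely positive map M to H
    ([dilation_phi_F_cp]).

    Conversely, let every phi_F be completely positive. In a dilation with pi
    unital one has pi(a) V(p) = V(p) pi(beta_p^-1(a)), and this forces the inner product of
    pi(a) V(p) h and pi(b) V(q) k to be
       < phi(beta_r^-1(b^* a)) T(p^-1 r)^* h , T(q^-1 r)^* k >
    when pP and qP meet in rP, and 0 otherwise. This formula defines a kernel on
    P x A x H, and it remains to prove that the kernel is positive
    ([dilation_kernel_positive]). For that, cut a finite combination of the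
    vectors pi(a_i) V(p_i) h_i by the commuting projections V(p_i) V(p_i)^* and
    their complements. On a piece where the projection of p_i is complemented,
    the i-th vector disappears; on the other pieces the quadratic form is the
    positive form of phi_G, for G a left translate of part of {p_1, ..., p_n},
    pulled back by adjoints of operators of T.

    The dilation space is the reproducing kernel Hilbert space of the kernel. Its
    elements are functions on P x A x H, and the operators pi(a), V(p) and their
    adjoints are compositions with explicit maps of P x A x H to itself, so that
    each required relation is an identity between such maps. Two analytic facts
    enter: bounded operators have adjoints (by Riesz representation, [riesz]),
    and C 1 - b^* b has the form c^* c for C large ([cstar_norm_bound]), which
    makes pi(b) bounded. *)

(** * Inner products and bounded operators *)

(** The core of the Cauchy-Schwarz inequality, with a = <x, x>, z = <y, x> and
    b = <y, y>. Stated for numbers, it serves both Hilbert spaces and positive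
    kernels, whose form may be degenerate. *)
Lemma discriminant_le (C : numClosedFieldType) (a b z : C) : 0 <= b ->
  (forall t, 0 <= a + t * z + (t * z)^* + `|t| ^+ 2 * b) -> `|z| ^+ 2 <= a * b.
Proof.
move=> b0 H.
have a0 : 0 <= a by have := H 0; rewrite normr0 expr0n /= !mul0r conjC0 !addr0.
have key (c : C) : 0 <= c -> 0 <= a - 2 * c * `|z| ^+ 2 + c ^+ 2 * `|z| ^+ 2 * b.
  move=> c0; have := H (- c * z^*).
  have -> : - c * z^* * z = - (c * `|z| ^+ 2) by rewrite normCK; ring.
  rewrite normrM normrN norm_conjC exprMn (ger0_norm c0).
  have /conj_Creal -> : - (c * `|z| ^+ 2) \is Num.real.
    by rewrite rpredN ger0_real // mulr_ge0 // exprn_ge0.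
  by congr (0 <= _); ring.
have [b00|bn0] := eqVneq b 0.
  have [->|zn0] := eqVneq z 0; first by rewrite normr0 expr0n /= mulr_ge0.
  have z2 : 0 < `|z| ^+ 2 by rewrite exprn_gt0 // normr_gt0.
  have := key ((a + 1) / (2 * `|z| ^+ 2)).
  rewrite b00 mulr0 addr0 => /(_ _)/wrap[].
    by apply: divr_ge0; [apply: addr_ge0 | apply: mulr_ge0 => //; apply: ltW].
  have -> : a - 2 * ((a + 1) / (2 * `|z| ^+ 2)) * `|z| ^+ 2 = - 1.
    by field; rewrite normr_eq0.
  by rewrite oppr_ge0 ler10.
have b1 : 0 < b by rewrite lt_def bn0.
have := key b^-1; rewrite invr_ge0 => /(_ b0).
have -> : a - 2 * b^-1 * `|z| ^+ 2 + b^-1 ^+ 2 * `|z| ^+ 2 * b = a - `|z| ^+ 2 / b.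
  by field.
by rewrite subr_ge0 ler_pdivrMr.
Qed.

Section Dotp.
Variables (R : realType) (H : hilbertType R).
Implicit Types x y z : H.
Local Notation dotp := (@dotp R H).

Lemma dotpDl x y z : dotp (x + y) z = dotp x z + dotp y z.
Proof. exact: linearDl. Qed.
Lemma dotpDr x y z : dotp x (y + z) = dotp x y + dotp x z.
Proof. exact: linearDr. Qed.
Lemma dotpBl x y z : dotp (x - y) z = dotp x z - dotp y z.
Proof. exact: linearBl. Qed.
Lemma dotpBr x y z : dotp x (y - z) = dotp x y - dotp x z.
Proof. exact: linearBr. Qed.
Lemma dotpZl c x y : dotp (c *: x) y = c * dotp x y.
Proof. exact: linearZl_LR. Qed.
Lemma dotpZr c x y : dotp x (c *: y) = c^* * dotp x y.
Proof. exact: linearZr_LR. Qed.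
Lemma dotp0l x : dotp 0 x = 0. Proof. exact: linear0l. Qed.
Lemma dotp0r x : dotp x 0 = 0. Proof. exact: linear0r. Qed.
Lemma dotpC x y : dotp x y = (dotp y x)^*.
Proof. by rewrite hermC /= expr0 mul1r. Qed.
Lemma dotp_suml I (r : seq I) (P : pred I) (F : I -> H) y :
  dotp (\sum_(i <- r | P i) F i) y = \sum_(i <- r | P i) dotp (F i) y.
Proof. exact: linear_sumlz. Qed.
Lemma dotp_sumr I (r : seq I) (P : pred I) (F : I -> H) y :
  dotp y (\sum_(i <- r | P i) F i) = \sum_(i <- r | P i) dotp y (F i).
Proof. exact: linear_sumr. Qed.
Lemma dotp_ge0 x : 0 <= dotp x x.
Proof. by rewrite -norm_dotp exprn_ge0. Qed.

Lemma dotp_CS x y : `|dotp x y| <= `|x| * `|y|.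
Proof.
rewrite -(@ler_pXn2r _ 2) ?nnegrE ?mulr_ge0 // exprMn !norm_dotp.
rewrite dotpC norm_conjC; apply: discriminant_le => [|t]; first exact: dotp_ge0.
have := dotp_ge0 (x + t *: y).
rewrite dotpDl !dotpDr !dotpZl !dotpZr normCK rmorphM /= -dotpC.
by congr (0 <= _); ring.
Qed.

Lemma dotp_ext x y : (forall z, dotp x z = dotp y z) -> x = y.
Proof.
move=> xy; apply/eqP; rewrite -subr_eq0 -normr_eq0 -sqrf_eq0 norm_dotp.
by rewrite dotpBl xy subrr.
Qed.

Lemma dotp_extr x y : (forall z, dotp z x = dotp z y) -> x = y.
Proof. by move=> xy; apply: dotp_ext => z; rewrite dotpC xy -dotpC. Qed.

End Dotp.

Section Linear.
Variables (C : pzRingType) (U V : lmodType C) (f : U -> V) (fL : linear f).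

Lemma linD x y : f (x + y) = f x + f y.
Proof. by have := fL 1 x y; rewrite !scale1r. Qed.
Lemma lin0 : f 0 = 0.
Proof. by apply: (@addrI _ (f 0)); rewrite -linD !addr0. Qed.
Lemma linZ c x : f (c *: x) = c *: f x.
Proof. by have := fL c x 0; rewrite lin0 !addr0. Qed.
Lemma linB x y : f (x - y) = f x - f y.
Proof. by rewrite -scaleN1r linD linZ scaleN1r. Qed.
Lemma lin_sum I (r : seq I) (P : pred I) (F : I -> U) :
  f (\sum_(i <- r | P i) F i) = \sum_(i <- r | P i) f (F i).
Proof. by apply: (big_morph f linD lin0). Qed.

End Linear.

Section BoundedOp.
Variables (R : realType) (H K : hilbertType R) (S : H -> K).

Lemma bounded_opP : linear S ->
  (continuous S <-> exists2 M : R[i], 0 <= M & forall x, `|S x| <= M * `|x|).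
Proof.
move=> Sl; pose L := GRing.isLinear.Build _ _ _ _ S Sl.
pose f : {linear H -> K} := HB.pack S L.
rewrite -[S]/(f : H -> K) -linear_bounded_continuous; split.
  by move=> /linear_boundedP /pinfty_ex_gt0 [M M0 fM]; exists M => //; exact: ltW.
move=> [M M0 fM]; apply/linear_boundedP; near=> r => x.
apply: (le_trans (fM x)); apply: ler_wpM2r => //.
by near: r; apply: nbhs_pinfty_ge; exact: ger0_real.
Unshelve. all: by end_near. Qed.

Lemma bounded_op_intro (M : R[i]) : 0 <= M -> linear S ->
  (forall x, `|S x| <= M * `|x|) -> bounded_op S.
Proof. by move=> M0 Sl SM; split=> //; apply/bounded_opP => //; exists M. Qed.

Lemma bounded_op_bound : bounded_op S ->
  exists2 M : R[i], 0 <= M & forall x, `|S x| <= M * `|x|.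
Proof. by move=> [Sl Sc]; apply/bounded_opP. Qed.

End BoundedOp.

(** The form in which limits are taken: an element that is within [N * e] of 0
    for all small [e] vanishes. Only [e <= 1] is asked for, so that products of
    two errors may be absorbed in [N]. *)
Lemma small_eq0 (C : numFieldType) (V : normedZmodType C) (N : C) (w : V) :
  0 <= N -> (forall e, 0 < e -> e <= 1 -> `|w| <= N * e) -> w = 0.
Proof.
move=> N0 H; apply/eqP; rewrite -normr_le0; apply/ler_addgt0Pr => d d0.
have Nd : 0 < N + d by rewrite ltr_wpDl.
rewrite add0r; apply: le_trans (H (d / (N + d)) _ _) _.
- exact: divr_gt0.
- by rewrite ler_pdivrMr // mul1r lerDr.
- by rewrite mulrCA ger_pMr // ler_pdivrMr // mul1r lerDl ltW.
Qed.

(** * Riesz representation and adjoints *)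

Section ComplexRe.
Variable R : realType.
Local Notation Re := (@complex.Re R).
Local Notation Im := (@complex.Im R).
Local Notation "x %:C" := (real_complex R x).

Lemma ReD (x y : R[i]) : Re (x + y) = Re x + Re y.
Proof. by case: x y => [? ?] [? ?]. Qed.
Lemma ReB (x y : R[i]) : Re (x - y) = Re x - Re y.
Proof. by case: x y => [? ?] [? ?]. Qed.
Lemma ReZ (c : R) (y : R[i]) : Re (c%:C * y) = c * Re y.
Proof. by case: y => [a b] /=; rewrite mul0r subr0. Qed.
Lemma Re_conjC (x : R[i]) : Re x^* = Re x.
Proof. by case: x => [? ?]. Qed.
Lemma ReiM (x : R[i]) : Re (complex.Complex 0 1 * x) = - Im x.
Proof. by case: x => [a b] /=; rewrite mul0r mul1r add0r. Qed.
Lemma ge0_ReE (x : R[i]) : 0 <= x -> x = (Re x)%:C.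
Proof. by move=> x0; rewrite RRe_real // ger0_real. Qed.
Lemma Re_ge0 (x : R[i]) : 0 <= x -> 0 <= Re x.
Proof. by move=> x0; rewrite -lecR -ge0_ReE. Qed.
Lemma Re_gt0 (x : R[i]) : 0 < x -> 0 < Re x.
Proof. by move=> x0; rewrite -ltcR -ge0_ReE ?ltW. Qed.
Lemma Re_norm (z : R[i]) : Re z <= Re `|z|.
Proof.
rewrite -lecR -(ge0_ReE (normr_ge0 z)); apply: le_trans (normc_ge_Re z).
by rewrite lecR ler_norm.
Qed.

Lemma near_invn_lt (e : R[i]) : 0 < e -> \forall n \near \oo, (n.+1%:R^-1 : R[i]) < e.
Proof.
move=> e0; have := near_infty_natSinv_lt (PosNum (Re_gt0 e0)).
apply: filterS => n /=; rewrite -ltcR -ge0_ReE ?(ltW e0) //.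
by rewrite fmorphV rmorph_nat.
Qed.

End ComplexRe.

Section Riesz.
Variables (R : realType) (H : hilbertType R).
Local Notation Re := (@complex.Re R).
Local Notation "x %:C" := (real_complex R x).
Implicit Types x y z : H.

Let rd x y : R := Re (dotp x y).

Let rdC x y : rd x y = rd y x.
Proof. by rewrite /rd dotpC Re_conjC. Qed.
Let rdD x y z : rd (x + y) z = rd x z + rd y z.
Proof. by rewrite /rd dotpDl ReD. Qed.
Let rdB x y z : rd (x - y) z = rd x z - rd y z.
Proof. by rewrite /rd dotpBl ReB. Qed.
Let rdZ (t : R) x z : rd (t%:C *: x) z = t * rd x z.
Proof. by rewrite /rd dotpZl ReZ. Qed.
Let rdE x : rd x x = (Re `|x|) ^+ 2.
Proof.
rewrite /rd -norm_dotp [in LHS](@ge0_ReE _ `|x|) //.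
by rewrite -(rmorphXn (real_complex R)).
Qed.
Let rd_ge0 x : 0 <= rd x x. Proof. by rewrite rdE sqr_ge0. Qed.

(** The representing vector minimizes J(x) = |x|^2 - 2 Re f(x). By the
    parallelogram law any minimizing sequence is Cauchy, and at its limit y the
    first variation Re <y, z> - Re f(z) vanishes in every direction z. The case
    of complex values follows by replacing z with iz. *)
Lemma riesz (f : H -> R[i]) (M : R[i]) : 0 <= M ->
  (forall c x y, f (c *: x + y) = c * f x + f y) ->
  (forall x, `|f x| <= M * `|x|) -> exists y, forall x, f x = dotp x y.
Proof.
move=> M0 fl fM.
pose g x := Re (f x).
have gE (t : R) x y : g (t%:C *: x + y) = t * g x + g y by rewrite /g fl ReD ReZ.
pose J x := rd x x - 2 * g x.
have JE (t : R) x z : J (t%:C *: z + x) =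
    J x + 2 * t * (rd x z - g z) + t ^+ 2 * rd z z.
  rewrite /J gE rdD !rdZ ![rd _ (_ + _)]rdC !rdD !rdZ (rdC z x); ring.
have JP x y : rd (x - y) (x - y) = 2 * J x + 2 * J y - 4 * J ((2^-1)%:C *: (x - y) + y).
  rewrite JE /J rdB ![rd _ (_ - _)]rdC !rdB (rdC y x).
  have -> : g (x - y) = g x - g y.
    by rewrite /g -scaleN1r addrC fl mulN1r ReD; case: (f y) => ? ?; rewrite addrC.
  by field.
have Jlb : has_lbound (range J).
  exists (- (Re M) ^+ 2) => _ [x _ <-].
  have gx : g x <= Re M * Re `|x|.
    apply: le_trans (Re_norm (f x)) _; rewrite -lecR rmorphM /= -!ge0_ReE //; exact: fM.
  by rewrite /J rdE; have := sqr_ge0 (Re M - Re `|x|); lra.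
have Jhi : has_inf (range J) by split=> //; exists (J 0), 0.
set m := inf (range J).
have mJ x : m <= J x by apply: ge_inf => //; exists x.
have exu n : exists x, J x < m + n.+1%:R^-1.
  have [|_ [x _ <-] Jx] := @inf_adherent _ _ (n.+1%:R^-1) _ Jhi; last by exists x.
  by rewrite invr_gt0.
pose u n := projT1 (cid (exu n)).
have uP n : J (u n) < m + n.+1%:R^-1 := projT2 (cid (exu n)).
have ucauchy : cauchy (u @ \oo).
  apply/cauchy_ballP => e e0.
  have e4 : 0 < (Re e) ^+ 2 / 4 by rewrite divr_gt0 // exprn_gt0 // Re_gt0.
  have Hn := near_infty_natSinv_lt (PosNum e4).
  exists ([set x | J x < m + (Re e) ^+ 2 / 4], [set x | J x < m + (Re e) ^+ 2 / 4]) => /=.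
    by split; apply: (@filterS _ \oo _ _ _ _ Hn) => n /= nlt;
      apply: (lt_trans (uP n)); rewrite ltrD2l.
  move=> [x y] [/= Jx Jy]; rewrite -ball_normE /=.
  rewrite (ge0_ReE (normr_ge0 (x - y))) (ge0_ReE (ltW e0)) ltcR.
  rewrite -(@ltr_pXn2r _ 2) ?nnegrE ?Re_ge0 ?(ltW e0) // -rdE JP.
  by have := mJ ((2^-1)%:C *: (x - y) + y); lra.
have [y uy] : exists y, u @ \oo --> y.
  by have /cauchy_cvg /cvg_ex := ucauchy.
exists y.
have key z : g z = rd z y.
  apply/eqP; rewrite rdC eq_sym -subr_eq0 -normr_le0; apply/ler_addgt0Pr => e e0.
  have D0 : 0 < rd z z + 1 by rewrite ltr_wpDl.
  have e1 : 0 < (e / 2) ^+ 2 / (rd z z + 1) by rewrite divr_gt0 // exprn_gt0 // divr_gt0.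
  have e2 : 0 < (e / 2 / (Re `|z| + 1)) by rewrite divr_gt0 ?ltr_wpDl ?divr_gt0 ?Re_ge0.
  near \oo => n.
  have -> : rd y z - g z = rd (y - u n) z + (rd (u n) z - g z) by rewrite rdB; ring.
  rewrite add0r (le_trans (ler_normD _ _)) // [leRHS]splitr lerD //.
    have yu : Re `|y - u n| < e / 2 / (Re `|z| + 1).
      rewrite -ltcR -ge0_ReE //; near: n; apply: cvgr_dist_lt => //.
      by rewrite ltcR.
    have rn : `|rd (y - u n) z| <= Re `|y - u n| * Re `|z|.
      rewrite -lecR rmorphM /= -!ge0_ReE //.
      exact: le_trans (normc_ge_Re _) (dotp_CS _ _).
    apply: (le_trans rn).
    move/ltW: yu; rewrite ler_pdivlMr ?ltr_wpDl ?Re_ge0 // => yu.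
    by apply: le_trans yu; rewrite ler_wpM2l ?Re_ge0 // lerDl.
  rewrite -(@ler_pXn2r _ 2) ?nnegrE ?divr_ge0 ?(ltW e0) // real_normK ?num_real //.
  set dl := rd (u n) z - g z.
  (* the step that minimizes the quadratic t |-> J (u n + t z), up to the 1 added
     to keep the denominator positive *)
  have := mJ ((- dl / (rd z z + 1))%:C *: z + u n); rewrite JE -/dl.
  have nn : n.+1%:R^-1 < (e / 2) ^+ 2 / (rd z z + 1).
    by near: n; exact: (near_infty_natSinv_lt (PosNum e1)).
  have un := uP n.
  have -> : J (u n) + 2 * (- dl / (rd z z + 1)) * dl + (- dl / (rd z z + 1)) ^+ 2 * rd z z
     = J (u n) - dl ^+ 2 / (rd z z + 1) - dl ^+ 2 / (rd z z + 1) ^+ 2.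
    by field; rewrite gt_eqF.
  have : 0 <= dl ^+ 2 / (rd z z + 1) ^+ 2 by rewrite divr_ge0 ?sqr_ge0.
  move=> h1 h2; have : dl ^+ 2 / (rd z z + 1) <= (e / 2) ^+ 2 / (rd z z + 1).
    move: h1 h2 nn un; move: (J _) (n.+1%:R^-1) => j d.
    by move: ((e / 2) ^+ 2 / _) (dl ^+ 2 / _) (dl ^+ 2 / _ ^+ 2) => c a b; lra.
  by rewrite ler_pM2r ?invr_gt0.
move=> x; apply/eqP; rewrite eq_complex; apply/andP; split; first by apply/eqP; exact: key.
have := key (complex.Complex 0 1 *: x); rewrite /g /rd dotpZl.
have := fl (complex.Complex 0 1) x 0.
have f0 : f 0 = 0 by have := fl 1 0 0; rewrite scaler0 addr0 mul1r -[X in X = _]addr0 => /addrI.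
by rewrite addr0 f0 addr0 => ->; rewrite !ReiM => /oppr_inj ->.
Unshelve. all: by end_near. Qed.

End Riesz.

Section Adjoint.
Variable R : realType.
Implicit Types H K L : hilbertType R.

Lemma adj_unique H K (S : H -> K) S' :
  (forall x y, dotp (S x) y = dotp x (S' y)) -> adj S = S'.
Proof.
move=> SS'; rewrite /adj; case: xgetP => [S2 _ /= SS2|/(_ S')] //.
apply/funext => y; apply: dotp_extr => x.
by rewrite -SS2 SS'.
Qed.

(** Riesz representation of the functionals x |-> <S x, y>. *)
Lemma adjE H K (S : H -> K) : bounded_op S ->
  forall x y, dotp (S x) y = dotp x (adj S y).
Proof.
move=> Sb; have [Sl _] := Sb; have [M M0 SM] := bounded_op_bound Sb.
have ex y : exists z, forall x, dotp (S x) y = dotp x z.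
  apply: (@riesz _ _ _ (M * `|y|)); first exact: mulr_ge0.
    by move=> c u v; rewrite Sl dotpDl dotpZl.
  move=> x; apply: le_trans (dotp_CS _ _) _.
  by rewrite mulrAC ler_wpM2r.
pose S' y := projT1 (cid (ex y)).
have SS' x y : dotp (S x) y = dotp x (S' y) := projT2 (cid (ex y)) x.
by move=> x y; rewrite (adj_unique SS').
Qed.

Lemma adjEr H K (S : H -> K) : bounded_op S ->
  forall x y, dotp x (S y) = dotp (adj S x) y.
Proof. by move=> Sb x y; rewrite dotpC adjE // -dotpC. Qed.

Lemma adj_linear H K (S : H -> K) : bounded_op S -> linear (adj S).
Proof.
move=> Sb c x y; apply: dotp_extr => z.
by rewrite -adjE // !dotpDr !dotpZr -!adjE.
Qed.

Lemma adj_bounded H K (S : H -> K) : bounded_op S -> bounded_op (adj S).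
Proof.
move=> Sb; have [M M0 SM] := bounded_op_bound Sb.
apply: (bounded_op_intro M0); first exact: adj_linear.
move=> y; have [->|ny] := eqVneq `|adj S y| 0; first exact: mulr_ge0.
have ny0 : 0 < `|adj S y| by rewrite lt_def ny normr_ge0.
rewrite -(ler_pM2l ny0) -expr2 norm_dotp -(adjE Sb).
have := dotp_CS (S (adj S y)) y.
rewrite (adjE Sb) ger0_norm ?dotp_ge0 // => /le_trans; apply.
by rewrite mulrA (mulrC _ M) ler_wpM2r.
Qed.

Lemma adj_comp H K L (S : K -> L) (S' : H -> K) :
  bounded_op S -> bounded_op S' -> adj (S \o S') = adj S' \o adj S.
Proof. by move=> Sb S'b; apply: adj_unique => x y /=; rewrite !adjE. Qed.

Lemma adjK H K (S : H -> K) : bounded_op S -> adj (adj S) = S.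
Proof. by move=> Sb; apply: adj_unique => x y; rewrite -(adjEr Sb). Qed.

Lemma adj_id H : adj (@id H) = id.
Proof. by apply: adj_unique. Qed.

Lemma comp_linear H K L (S : K -> L) (S' : H -> K) :
  linear S -> linear S' -> linear (S \o S').
Proof. by move=> Sl S'l c x y /=; rewrite S'l Sl. Qed.

Lemma comp_bounded H K L (S : K -> L) (S' : H -> K) :
  bounded_op S -> bounded_op S' -> bounded_op (S \o S').
Proof.
move=> Sb S'b; have [M M0 SM] := bounded_op_bound Sb.
have [M' M'0 SM'] := bounded_op_bound S'b.
apply: (@bounded_op_intro _ _ _ _ (M * M')); first exact: mulr_ge0.
  by apply: comp_linear; [case: Sb | case: S'b].
by move=> x /=; apply: le_trans (SM _) _; rewrite -mulrA ler_wpM2l.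
Qed.

Lemma linear_op0 H : linear (0 : H -> H).
Proof. by move=> c x y /=; rewrite scaler0 addr0. Qed.

Lemma bounded_op0 H : bounded_op (0 : H -> H).
Proof.
apply: (@bounded_op_intro _ _ _ _ 0) => // [|x]; first exact: linear_op0.
by rewrite normr0 mul0r.
Qed.

Lemma bounded_opD H (S S' : H -> H) :
  bounded_op S -> bounded_op S' -> bounded_op (S + S').
Proof.
move=> Sb S'b; have [M M0 SM] := bounded_op_bound Sb.
have [M' M'0 SM'] := bounded_op_bound S'b.
have [[Sl _] [S'l _]] := (Sb, S'b).
apply: (@bounded_op_intro _ _ _ _ (M + M')); first exact: addr_ge0.
  move=> c x y; rewrite !fctE Sl S'l scalerDr; rewrite !addrA; congr (_ + _).
  by rewrite -!addrA; congr (_ + _); rewrite addrC.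
by move=> x; rewrite mulrDl (le_trans (ler_normD _ _)) // lerD.
Qed.

Lemma bounded_opZ H (c : R[i]) (S : H -> H) :
  bounded_op S -> bounded_op (c *: S).
Proof.
move=> Sb; have [M M0 SM] := bounded_op_bound Sb; have [Sl _] := Sb.
apply: (@bounded_op_intro _ _ _ _ (`|c| * M)); first exact: mulr_ge0.
  by move=> d x y; rewrite !fctE Sl scalerDr !scalerA mulrC.
by move=> x; rewrite fctE normrZ -mulrA ler_wpM2l.
Qed.

End Adjoint.

(** * Positive kernels *)

Section Kernel.
Variables (R : realType) (X : Type) (k : X -> X -> R[i]).
Implicit Types (f g : X -> R[i]) (xi eta : seq (R[i] * X)).

(** A list [eta] of weighted points stands for the formal combination
    of the kernel vectors at its points; [pairing f eta] is then the inner product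
    of [f] with that combination. *)
Definition pairing f eta : R[i] := \sum_(v <- eta) v.1^* * f v.2.

Definition comb xi : X -> R[i] := fun y => \sum_(u <- xi) u.1 * k u.2 y.

Definition positive_kernel := forall xi, 0 <= pairing (comb xi) xi.

Definition scale_vec (c : R[i]) xi := [seq (c * u.1, u.2) | u <- xi].

(** [f] is a bounded functional of norm at most [M] on the formal combinations. *)
Definition dominated f (M : R[i]) :=
  forall eta, `|pairing f eta| <= M * sqrtC (pairing (comb eta) eta).

(** The closure, in the norm of bounded functionals, of the combinations of
    kernel vectors. It is a completion that needs neither a quotient nor
    Cauchy sequences. *)
Definition approximable f :=
  forall e : R[i], 0 < e -> exists xi, dominated (f - comb xi) e.

Lemma pairingDl f g eta : pairing (f + g) eta = pairing f eta + pairing g eta.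
Proof. by rewrite /pairing -big_split; apply: eq_bigr => v _; rewrite fctE mulrDr. Qed.

Lemma pairingZl c f eta : pairing (c *: f) eta = c * pairing f eta.
Proof.
rewrite /pairing big_distrr; apply: eq_bigr => v _.
by rewrite fctE mulrCA.
Qed.

Lemma pairingBl f g eta : pairing (f - g) eta = pairing f eta - pairing g eta.
Proof. by rewrite -scaleN1r pairingDl pairingZl mulN1r. Qed.

Lemma pairing_cat f eta eta' : pairing f (eta ++ eta') = pairing f eta + pairing f eta'.
Proof. exact: big_cat. Qed.

Lemma pairing_scale c f eta : pairing f (scale_vec c eta) = c^* * pairing f eta.
Proof.
rewrite /pairing /scale_vec big_map big_distrr; apply: eq_bigr => v _ /=.
by rewrite rmorphM mulrA.
Qed.

Lemma pairing1 f x : pairing f [:: (1, x)] = f x.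
Proof. by rewrite /pairing big_seq1 /= conjC1 mul1r. Qed.

Lemma comb_cat xi xi' : comb (xi ++ xi') = comb xi + comb xi'.
Proof. by apply/funext => y; rewrite /comb big_cat. Qed.

Lemma comb_scale c xi : comb (scale_vec c xi) = c *: comb xi.
Proof.
apply/funext => y; rewrite /comb /scale_vec big_map fctE /GRing.scale /= big_distrr.
by apply: eq_bigr => v _ /=; rewrite mulrA.
Qed.

Lemma comb1 x : comb [:: (1, x)] = k x.
Proof. by apply/funext => y; rewrite /comb big_seq1 mul1r. Qed.

Hypothesis kP : positive_kernel.

(** A complex quadratic form with real values is hermitian; two points with
    weights (c, 1), for c = 1 and c = i, suffice. *)
Lemma kernel_hermitian x y : k x y = (k y x)^*.
Proof.
have kR z : (k z z)^* = k z z.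
  have := kP [:: (1, z)]; rewrite pairing1 comb1 => /ger0_real.
  exact: conj_Creal.
have H c : c * k x y + c^* * k y x \is Num.real.
  have := ger0_real (kP ([:: (c, x)] ++ [:: (1, y)])).
  rewrite /pairing /comb !big_cat !big_seq1 /= !big_cons !big_nil.
  rewrite conjC1 !mul1r !addr0.
  set a := c^* * _; set b := (_ + k y y) => ab.
  have := ab; rewrite CrealE => /eqP; rewrite /a /b.
  rewrite !rmorphD !rmorphM /= !rmorphD !rmorphM !conjCK /= !kR => E.
  apply/CrealP; rewrite rmorphD !rmorphM /= conjCK.
  move: E; set p := k x y; set q := k y x => E.
  apply/eqP; rewrite -subr_eq0; apply/eqP.
  have {E} := congr1 (fun z => z - (c * c^* * k x x + k y y)) E.
  move=> E; transitivity (c * (c^* * k x x + q^*) + (c^* * p^* + k y y) -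
    (c * c^* * k x x + k y y) - (c * p + c^* * q)); first by ring.
  rewrite E; ring.
have := H 1; rewrite CrealE conjC1 !mul1r rmorphD /= => /eqP E1.
have := H 'i; rewrite CrealE rmorphD !rmorphM /= conjCK conjCi => /eqP E2.
have {}E2 : (k y x)^* - (k x y)^* = k x y - k y x.
  apply: (@mulfI _ ('i : R[i])); first exact: neq0Ci.
  by move: E2; rewrite !mulrBr !mulNr addrC.
have : 2 * k x y = 2 * (k y x)^*.
  transitivity ((k x y + k y x) + (k x y - k y x)); first by ring.
  by rewrite -E1 -E2; ring.
by apply: mulfI; rewrite pnatr_eq0.
Qed.

Lemma pairing_herm xi eta : pairing (comb xi) eta = (pairing (comb eta) xi)^*.
Proof.
rewrite /pairing /comb rmorph_sum /=.
under eq_bigr do rewrite mulr_sumr.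
rewrite exchange_big; apply: eq_bigr => u _ /=.
rewrite rmorphM /= conjCK rmorph_sum /= mulr_sumr; apply: eq_bigr => v _.
by rewrite rmorphM /= -kernel_hermitian mulrCA.
Qed.

Lemma comb_CS xi : dominated (comb xi) (sqrtC (pairing (comb xi) xi)).
Proof.
move=> eta; rewrite -(@ler_pXn2r _ 2) ?nnegrE ?mulr_ge0 ?sqrtC_ge0 // exprMn !sqrtCK.
rewrite pairing_herm norm_conjC; apply: discriminant_le => // t.
have := kP (xi ++ scale_vec t eta).
rewrite comb_cat comb_scale pairingDl pairingZl !pairing_cat !pairing_scale.
rewrite rmorphM /= (pairing_herm xi eta) normCK.
by congr (0 <= _); ring.
Qed.

Lemma norm_comb_ge0 xi : 0 <= sqrtC (pairing (comb xi) xi).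
Proof. by rewrite sqrtC_ge0. Qed.

Lemma dominatedD f g M N : dominated f M -> dominated g N -> dominated (f + g) (M + N).
Proof.
move=> fM gN eta; rewrite pairingDl mulrDl.
by apply: le_trans (ler_normD _ _) _; apply: lerD.
Qed.

Lemma dominatedZ c f M : dominated f M -> dominated (c *: f) (`|c| * M).
Proof. by move=> fM eta; rewrite pairingZl normrM -mulrA ler_wpM2l. Qed.

Lemma dominatedW f M N : M <= N -> dominated f M -> dominated f N.
Proof. by move=> MN fM eta; apply: le_trans (fM eta) _; rewrite ler_wpM2r ?norm_comb_ge0. Qed.

Lemma dominated_eq0 f : dominated f 0 -> f = 0.
Proof.
move=> f0; apply/funext => x; apply/eqP; rewrite -normr_le0 -pairing1.
by apply: le_trans (f0 _) _; rewrite mul0r.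
Qed.

Lemma approximable_comb xi : approximable (comb xi).
Proof.
move=> e e0; exists xi => eta; rewrite subrr /pairing big1 ?normr0.
  by rewrite mulr_ge0 ?norm_comb_ge0 ?ltW.
by move=> i _; rewrite mulr0.
Qed.

Lemma approximableD f g : approximable f -> approximable g -> approximable (f + g).
Proof.
move=> fa ga e e0; have e2 : 0 < e / 2 by rewrite divr_gt0.
have [[xi fx] [et ge]] := (fa _ e2, ga _ e2).
exists (xi ++ et); rewrite comb_cat opprD addrACA [e]splitr.
exact: dominatedD.
Qed.

Lemma approximableZ c f : approximable f -> approximable (c *: f).
Proof.
move=> fa e e0; have c0 : 0 < `|c| + 1 by rewrite ltr_wpDl.
have [xi fx] := fa (e / (`|c| + 1)) (divr_gt0 e0 c0).
exists (scale_vec c xi); rewrite comb_scale -scalerBr.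
apply: (dominatedW _ (dominatedZ c fx)).
by rewrite mulrCA ger_pMr // ler_pdivrMr // mul1r lerDl.
Qed.

Lemma approximable_dominated f : approximable f ->
  exists2 M : R[i], 0 <= M & dominated f M.
Proof.
move=> /(_ 1 ltr01) [xi fx]; exists (1 + sqrtC (pairing (comb xi) xi)).
  by rewrite addr_ge0 ?norm_comb_ge0.
by rewrite -(subrK (comb xi) f); apply: dominatedD => //; exact: comb_CS.
Qed.

End Kernel.

(** * The normed space of a positive kernel *)

Section ComplexComplete.
Variable R : realType.
Local Notation Re := (@complex.Re R).
Local Notation Im := (@complex.Im R).
Local Notation "x %:C" := (real_complex R x).

Lemma ImB (x y : R[i]) : Im (x - y) = Im x - Im y.
Proof. by case: x y => [? ?] [? ?]. Qed.

Lemma normr_ge_Im (z : R[i]) : `|Im z|%:C <= `|z|.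
Proof.
have := normc_ge_Re (complex.Complex 0 1 * z); rewrite ReiM normrN.
by rewrite normrM [X in X * `|z|](_ : _ = 1) ?mul1r // normc_def /= expr0n expr1n add0r sqrtr1.
Qed.

Lemma norm_le_ReIm (z : R[i]) : `|z| <= `|Re z|%:C + `|Im z|%:C.
Proof.
rewrite {1}[z]complexE; apply: le_trans (ler_normD _ _) _.
rewrite normrM !normc_def /= !expr0n !expr1n /= !addr0 add0r sqrtr1 mul1r.
by rewrite !sqrtr_sqr.
Qed.

Lemma complex_complete (F : set_system R[i]^o) : ProperFilter F -> cauchy F -> cvg F.
Proof.
move=> FF /cauchy_ballP cF.
have cp (p : R[i]^o -> R) : (forall x y, `|p x - p y|%:C <= `|x - y|) -> cvg (p @ F).
  move=> pL; have pF : ProperFilter (p @ F) by exact: fmap_proper_filter.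
  apply: cauchy_cvg; apply/cauchy_ballP => e e0.
  have eC : 0 < e%:C by rewrite ltcR.
  have [[A B] /= [FA FB] AB] := cF _ eC.
  exists (p @` A, p @` B) => /=.
    by split; [apply: filterS FA | apply: filterS FB] => z Az; exists z.
  move=> [_ _] [/= [x Ax <-] [y By <-]].
  have := AB (x, y) (conj Ax By); rewrite -!ball_normE /= => xy.
  by rewrite -ltcR (le_lt_trans (pL _ _)).
have /cvg_ex [a Fa] : cvg ((Re : R[i]^o -> R) @ F).
  by apply: cp => x y; rewrite -ReB; exact: normc_ge_Re.
have /cvg_ex [b Fb] : cvg ((Im : R[i]^o -> R) @ F).
  by apply: cp => x y; rewrite -ImB; exact: normr_ge_Im.
apply/cvg_ex; exists (complex.Complex a b); apply/cvgrPdist_lt => e e0.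
have e2 : 0 < Re e / 2 by rewrite divr_gt0 // Re_gt0.
move/cvgrPdist_lt : Fa => /(_ _ e2) Fa; move/cvgrPdist_lt : Fb => /(_ _ e2) Fb.
near=> z; apply: (le_lt_trans (norm_le_ReIm _)).
rewrite (ge0_ReE (ltW e0)) [Re e]splitr rmorphD /= ltrD // ltcR.
  rewrite ReB /=; near: z; exact: Fa.
rewrite ImB /=; near: z; exact: Fb.
Unshelve. all: by end_near. Qed.

End ComplexComplete.


Definition kernel_pred (R : realType) (X : Type) (k : X -> X -> R[i])
  of positive_kernel k : {pred X -> R[i]} := fun f => `[< approximable k f >].

Section KernelSpace.
Variables (R : realType) (X : Type) (k : X -> X -> R[i]) (kP : positive_kernel k).

Lemma kernel_submod_closed : submod_closed (kernel_pred kP).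
Proof.
split.
  apply/asboolP => e e0; exists [::].
  have : @comb R X k [::] = 0 by apply/funext => y; rewrite /comb big_nil.
  move=> c0 eta; rewrite c0 subrr /pairing big1 ?normr0.
    by rewrite mulr_ge0 ?norm_comb_ge0 ?ltW.
  by move=> i _; rewrite mulr0.
move=> c f g /asboolP fa /asboolP ga; apply/asboolP.
by apply: approximableD => //; exact: approximableZ.
Qed.

HB.instance Definition _ :=
  GRing.isSubmodClosed.Build R[i] (X -> R[i]) (kernel_pred kP) kernel_submod_closed.

(** The reproducing kernel Hilbert space. The positivity proof is a parameter of
    the type because the norm axioms depend on it. *)
Record kernel_space := KernelSpace {
  kernel_val :> X -> R[i] ; _ : kernel_val \in kernel_pred kP }.

HB.instance Definition _ := [isSub for kernel_val].
HB.instance Definition _ := [Choice of kernel_space by <:].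
HB.instance Definition _ := [SubChoice_isSubLmodule of kernel_space by <:].

Local Notation K := kernel_space.
Implicit Types f g : K.

Lemma kernel_valD f g : kernel_val (f + g) = kernel_val f + kernel_val g.
Proof. by []. Qed.
Lemma kernel_valZ c f : kernel_val (c *: f) = c *: kernel_val f.
Proof. by []. Qed.

Lemma kernel_space_dominated f : exists2 M : R[i], 0 <= M & dominated k f M.
Proof. by apply: approximable_dominated => //; exact/asboolP/(valP f). Qed.

Definition knorm f : R[i] :=
  real_complex R (inf [set M : R | 0 <= M /\ dominated k f (real_complex R M)]).

Let has_inf_knorm f : has_inf [set M : R | 0 <= M /\ dominated k f (real_complex R M)].
Proof.
split; last by exists 0 => M [].
have [M M0 fM] := kernel_space_dominated f.
by exists (complex.Re M); split; [exact: Re_ge0 | rewrite -ge0_ReE].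
Qed.

Lemma knorm_ge0 f : 0 <= knorm f.
Proof.
rewrite ler0c; apply: lb_le_inf; first by case: (has_inf_knorm f).
by move=> M [].
Qed.

Lemma knorm_dominated f : dominated k f (knorm f).
Proof.
move=> eta; set n := sqrtC _.
have [n0|nn0] := eqVneq n 0.
  have [M M0 /(_ eta)] := kernel_space_dominated f.
  by rewrite -/n n0 !mulr0.
have n1 : 0 < n by rewrite lt_def nn0 norm_comb_ge0.
rewrite -ler_pdivrMr // (@ge0_ReE _ (_ / _)) ?divr_ge0 ?(ltW n1) // /knorm lecR.
apply: lb_le_inf; first by case: (has_inf_knorm f).
move=> M [M0 fM]; rewrite -lecR -ge0_ReE ?divr_ge0 ?(ltW n1) //.
by rewrite ler_pdivrMr //; exact: fM.
Qed.

Lemma knorm_le f M : 0 <= M -> dominated k f M -> knorm f <= M.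
Proof.
move=> M0 fM; rewrite [M]ge0_ReE // /knorm lecR; apply: ge_inf.
  by case: (has_inf_knorm f).
by split; [exact: Re_ge0 | rewrite -ge0_ReE].
Qed.

Lemma knormD f g : knorm (f + g) <= knorm f + knorm g.
Proof.
apply: knorm_le; first by rewrite addr_ge0 ?knorm_ge0.
by apply: dominatedD; exact: knorm_dominated.
Qed.

Lemma knorm_eq0 f : knorm f = 0 -> f = 0.
Proof.
move=> f0; apply/val_inj; apply: (@dominated_eq0 _ _ k).
by rewrite -f0; exact: knorm_dominated.
Qed.

Lemma knormZ c f : knorm (c *: f) = `|c| * knorm f.
Proof.
have le d g : knorm (d *: g) <= `|d| * knorm g.
  apply: knorm_le; first by rewrite mulr_ge0 ?knorm_ge0.
  by apply: dominatedZ; exact: knorm_dominated.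
apply: le_anti; rewrite le /=.
have [->|c0] := eqVneq c 0; first by rewrite normr0 mul0r knorm_ge0.
have := le c^-1 (c *: f); rewrite scalerA mulVf // scale1r normfV.
by rewrite mulrC ler_pdivlMr ?normr_gt0 // mulrC.
Qed.

HB.instance Definition _ :=
  Lmodule_isNormed.Build R[i] kernel_space knormD knormZ knorm_eq0.

End KernelSpace.

(** * Completeness and inner product of the kernel space *)

(** The arguments of this section only use that [K] embeds by [ev] isometrically
    onto the approximable functions; they are carried out for such a [K] rather
    than for [kernel_space], whose topology is then not unfolded. *)
Section Evaluation.
Variables (R : realType) (X : Type) (k : X -> X -> R[i]) (kP : positive_kernel k).
Variables (K : normedModType R[i]) (ev : K -> X -> R[i]).
Hypothesis evL : linear ev.
Hypothesis ev_dominated : forall f, dominated k (ev f) `|f|.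
Hypothesis norm_le_ev : forall f M, 0 <= M -> dominated k (ev f) M -> `|f| <= M.
Hypothesis ev_onto : forall g, approximable k g -> exists f, ev f = g.
Hypothesis ev_approx : forall f, approximable k (ev f).
Implicit Types f g : K.

(** A Cauchy filter converges pointwise, and the pointwise limit is again
    dominated and approximable because these conditions pass to limits of
    pairings with a fixed combination. *)
Lemma evaluation_complete (F : set_system K) : ProperFilter F -> cauchy F -> cvg F.
Proof.
move=> FF /cauchy_ballP cF.
have eve x : cvg ((fun f : K => ev f x : R[i]^o) @ F).
  have pF : ProperFilter ((fun f : K => ev f x : R[i]^o) @ F) by exact: fmap_proper_filter.
  apply: complex_complete; apply/cauchy_ballP => e e0.
  set n := sqrtC (pairing (comb k [:: (1, x)]) [:: (1, x)]).
  have n0 : 0 <= n := norm_comb_ge0 kP _.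
  have n1 : 0 < n + 1 by rewrite ltr_wpDl.
  have [[A B] /= [FA FB] AB] := cF _ (divr_gt0 e0 n1).
  exists ((fun f : K => ev f x) @` A, (fun f : K => ev f x) @` B) => /=.
    by split; [apply: filterS FA | apply: filterS FB] => z Az; exists z.
  move=> [_ _] [/= [f Af <-] [g Bg <-]].
  have := AB (f, g) (conj Af Bg); rewrite -!ball_normE /= => fg.
  have := @ev_dominated (f - g) [:: (1, x)].
  rewrite pairing1 /= -/n (linB evL) => /le_lt_trans; apply.
  move: fg; rewrite ltr_pdivlMr // => /(le_lt_trans _); apply.
  by rewrite ler_wpM2l // lerDl.
pose g x : R[i] := lim ((fun f : K => ev f x : R[i]^o) @ F).
have gP x : (fun f : K => ev f x : R[i]^o) @ F --> (g x : R[i]^o) by exact: eve.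
have gpair eta (d : R[i]) : 0 < d -> \forall f \near F, `|pairing (ev f - g) eta| <= d.
  elim: eta d => [|v eta IH] d d0.
    by apply: nearW => f; rewrite /pairing big_nil normr0 ltW.
  have d2 : 0 < d / 2 by rewrite divr_gt0.
  have c0 : 0 < `|v.1| + 1 by rewrite ltr_wpDl.
  have /cvgrPdist_le /(_ _ (divr_gt0 d2 c0)) gx := gP v.2.
  apply: filterS2 gx (IH _ d2) => f fx fe; rewrite /pairing big_cons [d]splitr.
  apply: le_trans (ler_normD _ _) _; apply: lerD => //.
  rewrite normrM norm_conjC fctE distrC mulrC; rewrite ler_pdivlMr // in fx.
  by apply: le_trans fx; rewrite ler_wpM2l // lerDl.
have key (e : R[i]) : 0 < e -> \forall f \near F, dominated k (ev f - g) e.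
  move=> e0; have [[A B] /= [FA FB] AB] := cF _ e0.
  apply: filterS FA => f Af eta; apply/ler_addgt0Pr => d d0.
  have gd := gpair eta _ d0.
  near F => f'.
  rewrite (_ : ev f - g = ev (f - f') + (ev f' - g)); last first.
    by apply/funext => x; rewrite (linB evL) !fctE subrKA.
  rewrite pairingDl; apply: le_trans (ler_normD _ _) _; apply: lerD.
    apply: le_trans (ev_dominated _ _) _; apply: ler_wpM2r; first exact: norm_comb_ge0.
    have Bf' : B f' by near: f'.
    by have := AB (f, f') (conj Af Bf'); rewrite -ball_normE /= => /ltW.
  by near: f'.
have [h hg] : exists h, ev h = g.
  apply: ev_onto => e e0; have e2 : 0 < e / 2 by rewrite divr_gt0.
  have /filter_ex [f fg] := key _ e2.
  have [h hf] := ev_approx f e2.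
  exists h; rewrite (_ : g - comb k h = (-1) *: (ev f - g) + (ev f - comb k h)).
    rewrite [e]splitr; apply: dominatedD => //.
    by have := @dominatedZ _ _ k (-1) _ _ fg; rewrite normrN1 mul1r.
  by apply/funext => x; rewrite !fctE scaleN1r opprB subrKA.
apply/cvg_ex; exists h; apply/cvgrPdist_le => e e0.
near=> f; rewrite distrC; apply: norm_le_ev; first exact: ltW.
by rewrite (linB evL) hg; near: f; exact: key.
Unshelve. all: by end_near. Qed.

Lemma ev_inj f g : ev f = ev g -> f = g.
Proof.
move=> fg; apply/eqP; rewrite -subr_eq0 -normr_le0; apply: norm_le_ev => // eta.
by rewrite (linB evL) fg subrr /pairing big1 ?normr0 ?mul0r // => i _; rewrite mulr0.
Qed.

Let rep xi : K := projT1 (cid (ev_onto (approximable_comb kP xi))).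

Let evrep xi : ev (rep xi) = comb k xi := projT2 (cid (ev_onto (approximable_comb kP xi))).

Let normrep xi : `|rep xi| = sqrtC (pairing (comb k xi) xi).
Proof.
set n := sqrtC _; have n0 : 0 <= n := norm_comb_ge0 kP xi.
have n2 : n ^+ 2 = pairing (comb k xi) xi by rewrite sqrtCK.
apply: le_anti; apply/andP; split.
  by apply: norm_le_ev => //; rewrite evrep; exact: comb_CS.
have [->//|nn0] := eqVneq n 0.
have n1 : 0 < n by rewrite lt_def nn0.
have := ev_dominated (rep xi) xi; rewrite evrep -/n -n2 ger0_norm ?exprn_ge0 //.
by rewrite expr2 ler_pM2r.
Qed.

Let rep_sub xi eta : rep (xi ++ scale_vec (-1) eta) = rep xi - rep eta.
Proof.
apply: ev_inj; rewrite (linB evL) !evrep comb_cat comb_scale.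
by rewrite scaleN1r.
Qed.

Let B f eta := pairing (ev f) eta.

Let Bl c f g eta : B (c *: f + g) eta = c * B f eta + B g eta.
Proof. by rewrite /B evL pairingDl pairingZl. Qed.

Let BBl f g eta : B f eta - B g eta = B (f - g) eta.
Proof. by rewrite /B (linB evL) pairingBl. Qed.

Let Ble f eta : `|B f eta| <= `|f| * `|rep eta|.
Proof. by rewrite normrep; exact: ev_dominated. Qed.

Let Bsub f xi eta : `|B f xi - B f eta| <= `|f| * `|rep xi - rep eta|.
Proof.
rewrite -rep_sub; apply: le_trans (Ble _ _).
by rewrite /B pairing_cat pairing_scale rmorphN1 mulN1r.
Qed.

Let Brep xi eta : B (rep xi) eta = (B (rep eta) xi)^*.
Proof. by rewrite /B !evrep pairing_herm. Qed.

Let Bnorm xi : B (rep xi) xi = `|rep xi| ^+ 2.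
Proof. by rewrite /B evrep normrep sqrtCK. Qed.

Let dens f e : 0 < e -> exists xi, `|f - rep xi| <= e.
Proof.
move=> e0; have [xi fxi] := ev_approx f e0; exists xi; apply: norm_le_ev; first exact: ltW.
by rewrite (linB evL) evrep.
Qed.

(** [z] is the limit of [B f eta] as [rep eta] tends to [g], i.e. the inner
    product of [f] and [g]. The constant [M] is left free so that the relation is
    visibly additive in [f]; it still determines [z] by density. *)
Let isdot f g z := exists2 M : R[i], 0 <= M &
  forall eta, `|z - B f eta| <= M * `|g - rep eta|.

Let dens_eq0 (M : R[i]) g z : 0 <= M ->
  (forall eta, `|z| <= M * `|g - rep eta|) -> z = 0 :> R[i].
Proof.
move=> M0 H; apply/eqP; rewrite -normr_le0; apply/ler_addgt0Pr => e e0.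
have M1 : 0 < M + 1 by rewrite ltr_wpDl.
have [eta ge] := dens g (divr_gt0 e0 M1).
rewrite add0r; apply: le_trans (H eta) _; rewrite ler_pdivlMr // in ge.
by apply: le_trans ge; rewrite mulrC ler_wpM2l // lerDl.
Qed.

Let isdot_unique f g z z' : isdot f g z -> isdot f g z' -> z = z'.
Proof.
move=> [M M0 zM] [M' M'0 zM']; apply/eqP; rewrite -subr_eq0; apply/eqP.
apply: (@dens_eq0 (M + M') g); first exact: addr_ge0.
move=> eta; rewrite (_ : z - z' = (z - B f eta) - (z' - B f eta)).
  by apply: le_trans (ler_normB _ _) _; rewrite mulrDl lerD.
by rewrite opprB addrA addrNK.
Qed.

Let isdot_exists f g : exists z, isdot f g z.
Proof.
have ex n : exists xi, `|g - rep xi| <= n.+1%:R^-1 by apply: dens; rewrite invr_gt0.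
pose app n := projT1 (cid (ex n)).
have appP n : `|g - rep (app n)| <= n.+1%:R^-1 := projT2 (cid (ex n)).
pose u n := B f (app n) : R[i]^o.
have f1 : 0 < `|f| + 1 by rewrite ltr_wpDl.
have ucauchy : cauchy (u @ \oo).
  apply/cauchy_ballP => e e0.
  have e4 : 0 < e / 2 / (`|f| + 1) by rewrite !divr_gt0.
  pose A := [set z : R[i]^o | exists2 n, n.+1%:R^-1 < e / 2 / (`|f| + 1) & z = u n].
  exists (A, A); first by split; apply: filterS (near_invn_lt e4) => n ne; exists n.
  move=> [_ _] [/= [n ne ->] [m me ->]]; rewrite -ball_normE /=.
  apply: le_lt_trans (Bsub _ _ _) _.
  rewrite (_ : rep (app n) - rep (app m) = (g - rep (app m)) - (g - rep (app n))); last first.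
    by rewrite opprB [RHS]addrC subrKA.
  apply: (@le_lt_trans _ _ (`|f| * (m.+1%:R^-1 + n.+1%:R^-1))).
    by rewrite ler_wpM2l //; apply: le_trans (ler_normB _ _) _; rewrite lerD.
  apply: (@le_lt_trans _ _ ((`|f| + 1) * (m.+1%:R^-1 + n.+1%:R^-1))).
    by rewrite ler_wpM2r ?lerDl // addr_ge0 ?invr_ge0.
  by rewrite mulrC -ltr_pdivlMr // [e]splitr mulrDl ltrD.
have pu : ProperFilter (u @ \oo) by exact: fmap_proper_filter.
have /cvg_ex [z uz] : cvg (u @ \oo) by exact: complex_complete.
exists z, `|f| => // eta; apply/ler_addgt0Pr => e e0.
have e2 : 0 < e / 2 by rewrite divr_gt0.
move/cvgrPdist_le : uz => /(_ _ e2) uz.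
have s := near_invn_lt (divr_gt0 e2 f1).
near \oo => n.
rewrite (_ : z - B f eta = (z - u n) + (u n - B f eta)); last by rewrite subrKA.
apply: le_trans (ler_normD _ _) _.
have h1 : `|z - u n| <= e / 2 by near: n.
have h2 : `|u n - B f eta| <= `|f| * `|g - rep eta| + e / 2.
  apply: le_trans (Bsub _ _ _) _.
  rewrite (_ : rep (app n) - rep eta = (g - rep eta) - (g - rep (app n))); last first.
    by rewrite opprB [RHS]addrC subrKA.
  have nn : n.+1%:R^-1 < e / 2 / (`|f| + 1) by near: n.
  apply: (@le_trans _ _ (`|f| * (`|g - rep eta| + n.+1%:R^-1))).
    by rewrite ler_wpM2l //; apply: le_trans (ler_normB _ _) _; rewrite lerD.
  rewrite mulrDr lerD2l.
  apply: (@le_trans _ _ ((`|f| + 1) * n.+1%:R^-1)).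
    by rewrite ler_wpM2r ?lerDl // invr_ge0.
  by rewrite mulrC -ler_pdivlMr // ltW.
rewrite [in leRHS](splitr e) addrA addrC; exact: lerD.
Unshelve. all: by end_near. Qed.

Definition ev_dot f g : R[i] := projT1 (cid (isdot_exists f g)).

Let ev_dotP f g : isdot f g (ev_dot f g) := projT2 (cid (isdot_exists f g)).

Lemma ev_dot_linear c f f' g : ev_dot (c *: f + f') g = c * ev_dot f g + ev_dot f' g.
Proof.
apply: (isdot_unique (ev_dotP _ _)).
have [[M M0 fM] [M' M'0 fM']] := (ev_dotP f g, ev_dotP f' g).
exists (`|c| * M + M'); first by rewrite addr_ge0 ?mulr_ge0.
move=> eta; rewrite Bl opprD addrACA -mulrBr mulrDl.
by apply: le_trans (ler_normD _ _) _; rewrite normrM -mulrA lerD ?ler_wpM2l.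
Qed.

Let rep_le f e xi : e <= 1 -> `|f - rep xi| <= e -> `|rep xi| <= `|f| + 1.
Proof.
move=> e1 fe; rewrite -[rep xi](subKr f); apply: le_trans (ler_normB _ _) _.
by rewrite lerD2l (le_trans fe).
Qed.

(** Both sides are within small distance of the kernel form at approximations
    of [f] and [g], and that form is hermitian. *)
Lemma ev_dot_herm f g : ev_dot g f = (ev_dot f g)^*.
Proof.
have [[M M0 fM] [M' M'0 fM']] := (ev_dotP f g, ev_dotP g f).
apply/eqP; rewrite -subr_eq0; apply/eqP.
have key xi eta : `|ev_dot g f - (ev_dot f g)^*| <=
    (M' + `|rep eta|) * `|f - rep xi| + (M + `|rep xi|) * `|g - rep eta|.
  have -> : ev_dot g f - (ev_dot f g)^* =
     ((ev_dot g f - B g xi) + (B g xi - B (rep eta) xi)) -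
     ((ev_dot f g - B f eta) + (B f eta - B (rep xi) eta))^*.
    by rewrite !rmorphD !rmorphN /= -(Brep eta xi); ring.
  apply: le_trans (ler_normB _ _) _; rewrite norm_conjC.
  have h1 : `|B g xi - B (rep eta) xi| <= `|rep xi| * `|g - rep eta|.
    by rewrite BBl mulrC; exact: Ble.
  have h2 : `|B f eta - B (rep xi) eta| <= `|rep eta| * `|f - rep xi|.
    by rewrite BBl mulrC; exact: Ble.
  apply: le_trans (lerD (le_trans (ler_normD _ _) (lerD (fM' xi) h1))
    (le_trans (ler_normD _ _) (lerD (fM eta) h2))) _.
  by rewrite le_eqVlt; apply/orP; left; apply/eqP; ring.
apply: (@small_eq0 _ _ ((M' + (`|g| + 1)) + (M + (`|f| + 1)))).
  by rewrite !addr_ge0.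
move=> e e0 e1; have [xi fe] := dens f e0; have [eta ge] := dens g e0.
apply: le_trans (key xi eta) _; rewrite [leRHS]mulrDl; apply: lerD.
  by apply: ler_pM => //; rewrite ?addr_ge0 // lerD2l; exact: rep_le e1 ge.
by apply: ler_pM => //; rewrite ?addr_ge0 // lerD2l; exact: rep_le e1 fe.
Qed.

Lemma ev_dot_norm f : ev_dot f f = `|f| ^+ 2.
Proof.
have [M M0 fM] := ev_dotP f f.
apply/eqP; rewrite -subr_eq0; apply/eqP.
apply: (@small_eq0 _ _ (M + (`|f| + 1) + ((`|f| + 1) + `|f|))); first by rewrite !addr_ge0.
move=> e e0 e1; have [xi fe] := dens f e0.
have re := rep_le e1 fe.
have -> : ev_dot f f - `|f| ^+ 2 =
  (ev_dot f f - B f xi) + (B f xi - B (rep xi) xi) + (`|rep xi| ^+ 2 - `|f| ^+ 2).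
  by rewrite Bnorm; ring.
rewrite mulrDl; apply: le_trans (ler_normD _ _) _; apply: lerD.
  rewrite mulrDl; apply: le_trans (ler_normD _ _) _; apply: lerD.
    by apply: le_trans (fM xi) _; rewrite ler_wpM2l.
  by rewrite BBl; apply: le_trans (Ble _ _) _; rewrite mulrC; apply: ler_pM.
rewrite subr_sqr normrM mulrC; apply: ler_pM => //.
  by rewrite ger0_norm ?addr_ge0 // lerD2r.
apply: le_trans fe; rewrite distrC.
exact: ler_dist_dist.
Qed.

Lemma ev_dot_reproducing f h x : ev h = k x -> ev_dot f h = ev f x.
Proof.
move=> hx; have -> : h = rep [:: (1, x)] by apply: ev_inj; rewrite evrep comb1.
rewrite -(pairing1 (ev f)); apply: (isdot_unique (ev_dotP _ _)).
by exists `|f| => // eta; exact: Bsub.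
Qed.

End Evaluation.

(** * The reproducing kernel Hilbert space *)

Section KernelHilbert.
Variables (R : realType) (X : Type) (k : X -> X -> R[i]) (kP : positive_kernel k).
Local Notation K := (kernel_space kP).
Implicit Types f g : K.

Definition evaluation f : X -> R[i] := kernel_val f.

Lemma evaluation_linear : linear evaluation. Proof. by []. Qed.

Lemma evaluation_dominated f : dominated k (evaluation f) `|f|.
Proof. exact: knorm_dominated. Qed.

Lemma norm_le_evaluation f M : 0 <= M -> dominated k (evaluation f) M -> `|f| <= M.
Proof. exact: knorm_le. Qed.

Lemma evaluation_onto (g : X -> R[i]) : approximable k g -> exists f, evaluation f = g.
Proof. by move=> /asboolP ga; exists (KernelSpace ga). Qed.

Lemma evaluation_approx f : approximable k (evaluation f).
Proof. exact/asboolP/(valP f). Qed.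

Lemma kernel_space_complete (F : set_system K) : ProperFilter F -> cauchy F -> cvg F.
Proof.
exact: (evaluation_complete kP evaluation_linear evaluation_dominated
  norm_le_evaluation evaluation_onto evaluation_approx).
Qed.

HB.instance Definition _ :=
  @Uniform_isComplete.Build (kernel_space kP) kernel_space_complete.

Definition kernel_dot f g : R[i] :=
  ev_dot kP evaluation_linear evaluation_dominated
    norm_le_evaluation evaluation_onto evaluation_approx f g.

Lemma kernel_dotC f g : kernel_dot f g = (kernel_dot g f)^*.
Proof. exact: ev_dot_herm. Qed.

Lemma kernel_dot_linear c f f' g :
  kernel_dot (c *: f + f') g = c * kernel_dot f g + kernel_dot f' g.
Proof. exact: ev_dot_linear. Qed.

Lemma kernel_dot_norm f : `|f| ^+ 2 = kernel_dot f f.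
Proof. by rewrite /kernel_dot ev_dot_norm. Qed.

Lemma kernel_dot_bilinear :
  bilinear_for *%R (Num.conj \; *%R) (kernel_dot : K -> K -> R[i]).
Proof.
split=> [g c f f'|f c g g']; first exact: kernel_dot_linear.
by rewrite kernel_dotC kernel_dot_linear rmorphD rmorphM /= -!kernel_dotC.
Qed.

HB.instance Definition _ := @bilinear_isBilinear.Build R[i] K K R[i]
  *%R (Num.conj \; *%R) kernel_dot kernel_dot_bilinear.

Lemma kernel_dot_hermitian f g :
  kernel_dot f g = (-1) ^+ false * Num.conj (kernel_dot g f).
Proof. by rewrite expr0 mul1r kernel_dotC. Qed.

HB.instance Definition _ := @isHermitianSesquilinear.Build R[i] K false
  Num.conj kernel_dot kernel_dot_hermitian.

Lemma kernel_dot_gt0 f : f != 0 -> 0 < kernel_dot f f.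
Proof. by move=> f0; rewrite -kernel_dot_norm exprn_gt0 // normr_gt0. Qed.

HB.instance Definition _ := @isDotProduct.Build R[i] K kernel_dot kernel_dot_gt0.

HB.instance Definition _ := @CompleteNormedModule_isHilbert.Build R
  (kernel_space kP) kernel_dot kernel_dot_norm.

End KernelHilbert.

Section KernelVector.
Variables (R : realType) (X : Type) (k : X -> X -> R[i]) (kP : positive_kernel k).
Local Notation K := (kernel_space kP).
Implicit Types f g : K.

Lemma kernel_vec_subproof x : k x \in kernel_pred kP.
Proof. by apply/asboolP; rewrite -comb1; exact: approximable_comb. Qed.

Definition kernel_vec x : K := KernelSpace (kernel_vec_subproof x).

Lemma kernel_vecE x : kernel_val (kernel_vec x) = k x. Proof. by []. Qed.

(** The reproducing property. *)
Lemma dotp_kernel_vec f x : dotp f (kernel_vec x) = kernel_val f x.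
Proof. exact: ev_dot_reproducing. Qed.

Lemma kernel_space_ext f g : (forall x, kernel_val f x = kernel_val g x) -> f = g.
Proof. by move=> fg; apply/val_inj/funext. Qed.

End KernelVector.

(** * Composition operators *)

Section CompositionOperator.
Variables (R : realType) (X : Type) (k : X -> X -> R[i]) (kP : positive_kernel k).
Local Notation K := (kernel_space kP).
Implicit Types (f g : K) (s : X -> X).

(** If the operators sending the kernel vector at [x] to those at [s x] and [s' x]
    exist, this says that they are adjoint to each other. The first one is then
    composition of functions with [s']. *)
Definition kernel_adjoint s s' := forall x y, k (s x) y = k x (s' y).

Definition map_vec s (xi : seq (R[i] * X)) := [seq (u.1, s u.2) | u <- xi].

Definition kernel_bounded s := exists2 C : R[i], 0 <= C &
  forall xi, pairing (comb k (map_vec s xi)) (map_vec s xi) <= C ^+ 2 * pairing (comb k xi) xi.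

Lemma kernel_adjointC s s' : kernel_adjoint s s' -> kernel_adjoint s' s.
Proof. by move=> ss' x y; rewrite kernel_hermitian // -ss' -kernel_hermitian. Qed.

Lemma pairing_map (f : X -> R[i]) s eta : pairing f (map_vec s eta) = pairing (f \o s) eta.
Proof. by rewrite /pairing /map_vec big_map. Qed.

Lemma comb_map s s' xi : kernel_adjoint s s' -> comb k (map_vec s xi) = comb k xi \o s'.
Proof.
move=> ss'; apply/funext => y; rewrite /comb /map_vec big_map /=.
by apply: eq_bigr => u _; rewrite ss'.
Qed.

(** |S' xi|^2 = <S S' xi, xi> <= C |S' xi| |xi|. *)
Lemma kernel_bounded_adjoint s s' : kernel_adjoint s s' -> kernel_bounded s -> kernel_bounded s'.
Proof.
move=> ss' [C C0 sC]; exists C => // xi.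
set q := pairing _ _; have q0 : 0 <= q := kP _.
have [->|qn0] := eqVneq q 0; first by rewrite mulr_ge0 ?exprn_ge0.
have q1 : 0 < q by rewrite lt_def qn0.
pose z := map_vec s (map_vec s' xi).
have E : q = pairing (comb k z) xi.
  by rewrite /q pairing_map -(comb_map _ ss').
have h := comb_CS kP z xi; rewrite -E ger0_norm // in h.
have h2 : q ^+ 2 <= pairing (comb k z) z * pairing (comb k xi) xi.
  rewrite -(sqrtCK (pairing _ z)) -(sqrtCK (pairing _ xi)) -exprMn.
  by rewrite ler_pXn2r ?nnegrE ?mulr_ge0 ?norm_comb_ge0.
rewrite -(ler_pM2l q1) -expr2; apply: (le_trans h2).
rewrite mulrA; apply: ler_wpM2r; first exact: kP.
by rewrite mulrC; exact: sC.
Qed.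

(** The value 0 is taken when the composition leaves the space, which
    [comp_opE] excludes for adjoint pairs of bounded maps. *)
Definition comp_op s f : K := insubd 0 (kernel_val f \o s).

Section AdjointPair.
Variables (s s' : X -> X) (ss' : kernel_adjoint s s') (sb : kernel_bounded s).

Lemma kernel_bounded_dominated : exists2 C : R[i], 0 <= C &
  forall (f : X -> R[i]) (M : R[i]), 0 <= M ->
    dominated k f M -> dominated k (f \o s') (M * C).
Proof.
have [C C0 s'C] := kernel_bounded_adjoint ss' sb; exists C => // f M M0 fM eta.
rewrite -pairing_map; apply: le_trans (fM _) _; rewrite -mulrA ler_wpM2l //.
rewrite -(@ler_pXn2r _ 2) ?nnegrE ?mulr_ge0 ?norm_comb_ge0 //.
by rewrite exprMn !sqrtCK; exact: s'C.
Qed.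

Lemma comp_opE f : kernel_val (comp_op s' f) = kernel_val f \o s'.
Proof.
rewrite /comp_op [LHS]insubdK //; apply/asboolP => e e0.
have [C C0 domC] := kernel_bounded_dominated.
have C1 : 0 < C + 1 by rewrite ltr_wpDl.
have eC := divr_gt0 e0 C1.
have [xi fxi] := (evaluation_approx f) _ eC.
exists (map_vec s xi); rewrite (comb_map _ ss').
have := domC _ _ (ltW eC) fxi; apply: dominatedW => //.
by rewrite mulrAC ler_pdivrMr // ler_wpM2l ?(ltW e0) // lerDl.
Qed.

Lemma comp_op_bounded : bounded_op (comp_op s').
Proof.
have [C C0 domC] := kernel_bounded_dominated.
apply: (bounded_op_intro C0) => [c f g|f].
  by apply: kernel_space_ext => x; rewrite kernel_valD kernel_valZ !comp_opE.
apply: norm_le_evaluation; first exact: mulr_ge0.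
rewrite /evaluation comp_opE mulrC; apply: domC => //.
exact: evaluation_dominated.
Qed.

Lemma comp_op_vec x : comp_op s' (kernel_vec kP x) = kernel_vec kP (s x).
Proof. by apply: kernel_space_ext => y; rewrite comp_opE /= ss'. Qed.

Lemma comp_op_adj f x : kernel_val (adj (comp_op s') f) x = kernel_val f (s x).
Proof.
rewrite -dotp_kernel_vec dotpC -(adjE comp_op_bounded) comp_op_vec.
by rewrite -dotpC dotp_kernel_vec.
Qed.

End AdjointPair.

End CompositionOperator.

(** * Right ideals of a right LCM monoid *)

Section LCM.
Local Open Scope group_scope.
Variable P : monoidType.
Hypotheses (P_canc : cancellative P) (P_lcm : right_LCM P) (P_units : trivial_units P).
Implicit Types (p q r s : P) (x y z : option P).

(** [None] plays the role of the infinite element, so that principal right ideals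
    and the empty set form a semilattice isomorphic to [option P]. *)
Definition ideal x : set P := if x is Some p then right_ideal p else set0.

Lemma right_ideal_refl p : right_ideal p p.
Proof. by exists 1; rewrite ?mulg1. Qed.

Lemma right_idealP p r : right_ideal p r <-> exists u, r = p * u.
Proof. by split=> [[u _ <-]|[u ->]]; exists u. Qed.

Lemma ideal1 : ideal (Some 1) = setT.
Proof. by apply/seteqP; split=> // p _; exists p => //; rewrite mul1g. Qed.

(** This is where cancellation and the triviality of units are used: principal
    right ideals have a single generator. *)
Lemma ideal_inj : injective ideal.
Proof.
move=> [p|] [q|] //= E; last first.
- by have := right_ideal_refl q; rewrite -E.
- by have := right_ideal_refl p; rewrite E.
have [u qu] : exists u, p = q * u by apply/right_idealP; rewrite -E; exact: right_ideal_refl.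
have [v pv] : exists v, q = p * v by apply/right_idealP; rewrite E; exact: right_ideal_refl.
have [canl _] := P_canc.
have vu1 : v * u = 1 by apply: (canl p); rewrite mulg1 mulgA -pv -qu.
have uv1 : u * v = 1 by apply: (canl q); rewrite mulg1 mulgA -qu -pv.
by rewrite qu (P_units uv1 vu1) mulg1.
Qed.

Definition join x y : option P := xget None [set z | ideal z = ideal x `&` ideal y].

Lemma joinP x y : ideal (join x y) = ideal x `&` ideal y.
Proof.
suff [z zE] : exists z, ideal z = ideal x `&` ideal y.
  by rewrite /join; case: xgetP => [_ _ //|/(_ z)].
case: x y => [p|] [q|]; try by exists None; rewrite /= ?setI0 ?set0I.
by have [E|[r E]] := P_lcm p q; [exists None | exists (Some r)]; rewrite /= E.
Qed.

Lemma join_unique x y z : ideal z = ideal x `&` ideal y -> join x y = z.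
Proof. by move=> E; apply: ideal_inj; rewrite joinP. Qed.

Lemma joinC x y : join x y = join y x.
Proof. by apply: join_unique; rewrite joinP setIC. Qed.
Lemma joinA x y z : join x (join y z) = join (join x y) z.
Proof. by apply: join_unique; rewrite !joinP setIA. Qed.
Lemma joinAC x y z : join (join x y) z = join (join x z) y.
Proof. by rewrite -!joinA (joinC y). Qed.
Lemma joinxx x : join x x = x.
Proof. by apply: join_unique; rewrite setIid. Qed.
Lemma join_l x y : ideal x `<=` ideal y -> join x y = x.
Proof. by move=> xy; apply: join_unique; rewrite (setIidl xy). Qed.
Lemma join1x x : join (Some 1) x = x.
Proof. by apply: join_unique; rewrite ideal1 setTI. Qed.
Lemma joinNx x : join None x = None.
Proof. by apply: join_l; exact: sub0set. Qed.
Lemma join_sub x y : ideal (join x y) `<=` ideal x.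
Proof. by rewrite joinP; exact: subIsetl. Qed.

(** Left division: the [u] with [p * u = r]. The value is meaningful only for
    [r] in the ideal of [p]. *)
Definition ldiv p r : P := xget 1 [set u | p * u = r].

Lemma ldivK p u : ldiv p (p * u) = u.
Proof.
have [canl _] := P_canc.
by apply: xget_subset1 => // v w /= pv pw; apply: (canl p); rewrite /= pv pw.
Qed.

Lemma mul_ldiv p r : right_ideal p r -> p * ldiv p r = r.
Proof. by move=> /right_idealP [u ->]; rewrite ldivK. Qed.

Lemma ldiv_mul p r u : right_ideal p r -> ldiv p (r * u) = ldiv p r * u.
Proof. by move=> /right_idealP [v ->]; rewrite -mulgA !ldivK. Qed.

Lemma ldivv p : ldiv p p = 1.
Proof. by rewrite -{2}(mulg1 p) ldivK. Qed.

Lemma join_some p q r : join (Some p) (Some q) = Some r ->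
  right_ideal p r /\ right_ideal q r.
Proof.
move=> E; have := joinP (Some p) (Some q); rewrite E /= => Er.
have : right_ideal r r by exact: right_ideal_refl.
by rewrite Er => -[].
Qed.

Definition shift s x : option P := omap (fun u => s * u) x.

Lemma ideal_shift s x : ideal (shift s x) = (fun u => s * u) @` ideal x.
Proof.
case: x => [p|] /=; last by rewrite image_set0.
apply/seteqP; split=> [_ /right_idealP [u ->]|_ [_ /right_idealP [u ->] <-]].
  by exists (p * u); [exists u | rewrite mulgA].
by apply/right_idealP; exists u; rewrite mulgA.
Qed.

Lemma join_shift s x y : join (shift s x) (shift s y) = shift s (join x y).
Proof.
have [canl _] := P_canc.
apply: join_unique; rewrite !ideal_shift joinP; apply/seteqP; split.
  by move=> _ [u [xu yu] <-]; split; exists u.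
by move=> _ [[u xu <-] [v yv /canl uv]]; exists u => //; split=> //; rewrite -uv.
Qed.

Lemma shift_sub s x : ideal (shift s x) `<=` right_ideal s.
Proof. by rewrite ideal_shift => _ [u _ <-]; exists u. Qed.

Lemma lcm_setP (U : {fset P}) :
  ideal (lcm_set U) = \bigcap_(p in [set` U]) right_ideal p.
Proof.
set I := \bigcap_(p in _) _; have [z zI] : exists z, ideal z = I.
  have H (l : seq P) : exists z, ideal z = \bigcap_(p in [set` l]) right_ideal p.
    elim: l => [|p l [z IH]].
      by exists (Some 1); rewrite ideal1 set_nil bigcap_set0.
    exists (join (Some p) z); rewrite joinP IH /=.
    apply/seteqP; split=> [u [pu lu] q|u H].
      by rewrite /= inE => /orP[/eqP ->|ql] //; exact: lu.
    by split=> [|q ql]; apply: H; rewrite /= inE ?eqxx // ql orbT.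
  by have [z zE] := H (enum_fset U); exists z.
rewrite /lcm_set -/I; case: asboolP => [->//|I0].
case: z zI => [s sI|/esym //]; rewrite /=.
by case: xgetP => [_ _ //|/(_ s)].
Qed.

Lemma lcm_set0 : lcm_set (fset0 : {fset P}) = Some 1.
Proof.
by apply: ideal_inj; rewrite lcm_setP ideal1; apply/seteqP; split.
Qed.

Lemma lcm_setU1 p (U : {fset P}) : lcm_set (p |` U)%fset = join (Some p) (lcm_set U).
Proof.
apply: ideal_inj; rewrite joinP !lcm_setP; apply/seteqP; split=> [u H|u [pu Uu] q].
  by split=> [|q qU]; apply: H; rewrite /= !inE ?eqxx //; apply/orP; right.
by rewrite /= !inE => /orP[/eqP ->|qU] //; exact: Uu.
Qed.

(** [altsum f x l] is the sum of (-1)^|U| f(x v s_U) over the subsets U of [l]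
    (see [sum_fpowerset]). If f(x) is a projection with f(x) f(y) = f(x v y), it
    is the part of f(x) orthogonal to all f(p), p in [l]. The recursion on a list
    makes repetitions harmless ([altsum_mem]). *)
Section AlternatingSum.
Local Open Scope ring_scope.
Variables (V : zmodType).
Implicit Types (f : option P -> V) (l : seq P).

Fixpoint altsum f x l : V :=
  if l is p :: l' then altsum f x l' - altsum f (join x (Some p)) l' else f x.

Lemma eq_altsum f g x l : f =1 g -> altsum f x l = altsum g x l.
Proof. by move=> fg; elim: l x => //= p l IH x; rewrite !IH. Qed.

Lemma altsum_sum I (r : seq I) (F : I -> option P -> V) x l :
  altsum (fun y => \sum_(i <- r) F i y) x l = \sum_(i <- r) altsum (F i) x l.
Proof. by elim: l x => //= p l IH x; rewrite !IH sumrB. Qed.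

(** Taking away f(x v p) from f(x) leaves nothing when x already lies below p. *)
Lemma altsum_absorb f x p l : p \in l -> ideal x `<=` right_ideal p -> altsum f x l = 0.
Proof.
elim: l x => // q l IH x; rewrite inE => /orP[/eqP <-|pl] xp /=.
  by rewrite (join_l (y := Some p)) // subrr.
by rewrite !IH // ?subrr //; apply: subset_trans xp; exact: join_sub.
Qed.

Lemma altsum_mem f x p l : p \in l -> altsum f x (p :: l) = altsum f x l.
Proof.
move=> pl /=; rewrite (@altsum_absorb f (join x (Some p)) p) ?subr0 //.
by rewrite joinC; exact: join_sub.
Qed.

Lemma altsum_join f x z l : (forall y, f (join y z) = f y) ->
  altsum f (join x z) l = altsum f x l.
Proof. by move=> fz; elim: l x => //= p l IH x; rewrite joinAC !IH. Qed.

Lemma altsum_None f l : f None = 0 -> altsum f None l = 0.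
Proof. by move=> f0; elim: l => //= p l IH; rewrite joinNx IH subrr. Qed.

Definition shift_back s l : seq P :=
  pmap (fun p => omap (ldiv s) (join (Some s) (Some p))) l.

(** An alternating sum below [s] is the left translate by [s] of an alternating
    sum over the quotients of the joins of [s] with the elements of [l];
    elements that do not meet [s] contribute nothing and are dropped. *)
Lemma altsum_shift f s x l : f None = 0 ->
  altsum f (shift s x) l = altsum (f \o shift s) x (shift_back s l).
Proof.
move=> f0; elim: l x => //= p l IH x.
have -> : join (shift s x) (Some p) = join (shift s x) (join (Some s) (Some p)).
  by rewrite joinA (join_l (y := Some s)) //; exact: shift_sub.
case E: (join (Some s) (Some p)) => [r|] /=.
  have [sr _] := join_some E.
  by rewrite -[r in Some r](mul_ldiv sr) -[Some (s * _)%g]/(shift s (Some _)) join_shift !IH.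
by rewrite joinC joinNx altsum_None // subr0 IH.
Qed.

End AlternatingSum.

Lemma altsum_morph (V W : zmodType) (h : V -> W) (f : option P -> V) x (l : seq P) :
  {morph h : a b / (a - b)%R} -> h (altsum f x l) = altsum (h \o f) x l.
Proof. by move=> hB; elim: l x => //= p l IH x; rewrite hB !IH. Qed.

Section AlternatingSumPowerset.
Local Open Scope ring_scope.
Variables (C : pzRingType) (V : lmodType C).
Implicit Types (f : option P -> V) (l : seq P).

Lemma fpowersetU1 p (G : {fset P}) : p \notin G ->
  perm_eq (fpowerset (p |` G)%fset)
    (fpowerset G ++ [seq (p |` W)%fset | W <- fpowerset G]).
Proof.
move=> pG; apply: uniq_perm; first exact: fset_uniq.
  rewrite cat_uniq fset_uniq map_inj_in_uniq ?fset_uniq ?andbT.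
    apply/hasPn => _ /mapP[W _ ->]; apply/negP; rewrite fpowersetE => /fsubsetP/(_ p).
    by rewrite !inE eqxx (negPf pG) => /(_ isT).
  move=> W W'; rewrite !fpowersetE => WG W'G E.
  have pW : p \notin W by apply: contra pG; exact: (fsubsetP WG).
  have pW' : p \notin W' by apply: contra pG; exact: (fsubsetP W'G).
  by rewrite -(fsetU1K pW) -(fsetU1K pW') E.
move=> W; rewrite mem_cat !fpowersetE; apply/idP/orP => [WpG|].
  have [pW|pW] := boolP (p \in W); last first.
    left; apply/fsubsetP => q qW; have := fsubsetP WpG _ qW.
    by rewrite !inE => /orP[/eqP qp|//]; rewrite -qp qW in pW.
  right; apply/mapP; exists (W `\ p)%fset; last by rewrite fsetD1K.
  rewrite fpowersetE; apply/fsubsetP => q; rewrite !inE => /andP[qp qW].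
  by have := fsubsetP WpG _ qW; rewrite !inE (negPf qp).
case=> [WG|/mapP[W' + ->]]; first by apply: fsubset_trans WG _; exact: fsubsetU1.
by rewrite fpowersetE => W'G; exact: fsetUS.
Qed.

(** Split the subsets of p :: l according to whether they contain p. When [p]
    already occurs in [l] both sides are unchanged by it. *)
Lemma sum_fpowerset f l x :
  \sum_(U <- fpowerset [fset p in l]%fset) (-1 : C) ^+ #|` U|%fset *:
     f (join x (lcm_set U)) = altsum f x l.
Proof.
elim: l x => [|p l IH] x.
  rewrite (_ : [fset p in [::]]%fset = fset0); last by apply/fsetP => q; rewrite !inE.
  by rewrite fpowerset0 big_seq_fset1 cardfs0 expr0 scale1r lcm_set0 joinC join1x.
rewrite fset_cons; have [pl|pl] := boolP (p \in l).
  rewrite (_ : (p |` _)%fset = [fset p in l]%fset); first by rewrite altsum_mem.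
  by apply/fsetP => q; rewrite !inE; apply/orP/idP => [[/eqP ->|]|]; auto.
rewrite (perm_big _ (fpowersetU1 _)) /=; last by rewrite inE.
rewrite big_cat big_map IH /= -!IH; congr (_ + _).
rewrite -sumrN; apply: eq_big_seq => W; rewrite fpowersetE => /fsubsetP WG.
have pW : p \notin W by apply/negP => /WG; rewrite inE (negPf pl).
by rewrite lcm_setU1 joinA cardfsU1 pW exprS mulN1r scaleNr.
Qed.

End AlternatingSumPowerset.

End LCM.

(** * Squares in a unital C*-algebra *)

Section CStarFacts.
Variables (R : realType) (A : cstarType R).
Implicit Types a b c y z : A.

Lemma starB a b : star (a - b) = star a - star b.
Proof.
have N c : star (- c) = - star c by rewrite -scaleN1r starZ rmorphN1 scaleN1r.
by rewrite starD N.
Qed.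

Lemma star0 : star (0 : A) = 0.
Proof. by have := starB 0 0; rewrite !subrr. Qed.

Lemma cstar_starM a b : star (a * b) = star b * star a.
Proof. exact: starM. Qed.

Lemma star1 : star (1 : A) = 1.
Proof.
have := cstar_starM (star 1) 1; by rewrite mulr1 starK mulr1.
Qed.

Lemma norm_starM a b : `|a * b| <= `|a| * `|b|.
Proof. exact: cstar_normM. Qed.

Lemma norm_star a : `|star a| = `|a|.
Proof.
have le b : `|b| <= `|star b|.
  have [->|b0] := eqVneq `|b| 0; first exact: normr_ge0.
  have b1 : 0 < `|b| by rewrite lt_def b0 normr_ge0.
  by rewrite -(ler_pM2r b1) -expr2 -cstar_norm_star; exact: norm_starM.
by apply: le_anti; rewrite le andbT -{2}(starK a) le.
Qed.

Lemma cstar_scaleAl (c : R[i]) a b : c *: (a * b) = (c *: a) * b.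
Proof. exact: cstar_scalerAl. Qed.
Lemma cstar_scaleAr (c : R[i]) a b : c *: (a * b) = a * (c *: b).
Proof. exact: cstar_scalerAr. Qed.

(** If y = (a + y^2) / 2 then (1 - y)^2 = 1 - a. For |a| <= 3/4 the map
    y |-> (a + y^2) / 2 preserves the ball of radius 1/2 and is a contraction
    there with factor 1/2, so its iterates from 0 converge to such a y, which is
    self-adjoint because the iterates are. *)
Lemma cstar_sqrt_small a : star a = a -> `|a| <= 3 / 4 ->
  exists2 b, star b = b & b * b = 1 - a.
Proof.
move=> sa na.
pose f y := (2^-1 : R[i]) *: (a + y * y).
have h0 : 0 <= 2^-1 :> R[i] by [].
have nh : `|2^-1 : R[i]| = 2^-1 by rewrite ger0_norm.
have fstar y : star y = y -> star (f y) = f y.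
  move=> sy; rewrite /f starZ starD cstar_starM sa sy.
  by rewrite conj_Creal // ger0_real.
have fle y : `|y| <= 2^-1 -> `|f y| <= 2^-1.
  move=> ny; rewrite /f normrZ nh ger_pMr //.
  apply: le_trans (ler_normD _ _) _.
  apply: (@le_trans _ _ (3 / 4 + 2^-1 * 2^-1)).
    by apply: lerD => //; apply: le_trans (norm_starM _ _) _; exact: ler_pM.
  by rewrite le_eqVlt; apply/orP; left; apply/eqP; field.
have fdist y z : `|f y - f z| <= 2^-1 * ((`|y| + `|z|) * `|y - z|).
  rewrite /f -scalerBr normrZ nh ler_wpM2l //.
  have -> : a + y * y - (a + z * z) = y * (y - z) + (y - z) * z.
    by rewrite opprD addrACA subrr add0r mulrBr mulrBl subrKA.
  apply: le_trans (ler_normD _ _) _; rewrite [leRHS]mulrDl.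
  apply: lerD; first exact: norm_starM.
  by apply: le_trans (norm_starM _ _) _; rewrite mulrC.
pose y n := iter n f 0.
have ynorm n : `|y n| <= 2^-1.
  by elim: n => [|n IH] /=; [rewrite normr0 | exact: fle].
have ystar n : star (y n) = y n.
  by elim: n => [|n IH] /=; [exact: star0 | exact: fstar].
have ydist n m : `|y (n + m)%N - y n| <= 2^-1 ^+ n.+1.
  elim: n => [|n IH]; first by rewrite add0n expr1 subr0.
  rewrite addSn /= exprS; apply: le_trans (fdist _ _) _; rewrite ler_wpM2l //.
  apply: (@le_trans _ _ (1 * `|y (n + m)%N - y n|)); last by rewrite mul1r.
  rewrite ler_wpM2r // [leRHS](_ : 1 = 2^-1 + 2^-1); first by apply: lerD.
  by field.
have ydist' n m : `|y (n + m)%N - y n| <= n.+1%:R^-1.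
  apply: le_trans (ydist n m) _; rewrite exprVn lef_pV2 ?posrE ?exprn_gt0 //.
  by rewrite -natrX ler_nat; exact: ltnW (ltn_expl _ _).
have ycauchy : cauchy (y @ \oo).
  apply/cauchy_exP => e e0.
  have [n _ ne] := near_invn_lt e0.
  exists (y n), n => // m /= nm; rewrite -ball_normE /= distrC.
  rewrite -(subnKC nm); apply: le_lt_trans (ydist' _ _) _.
  by apply: ne => /=.
have /cvg_ex [z yz] : cvg (y @ \oo) by exact: cauchy_cvg.
have approx e : 0 < e -> exists n, `|z - y n| <= e /\ `|z - y n.+1| <= e.
  move=> e0; have /cvgrPdist_le /(_ _ e0) [n _ ne] := yz.
  by exists n; split; apply: ne => /=.
have zstar : star z = z.
  apply/eqP; rewrite -subr_eq0; apply/eqP; apply: (@small_eq0 _ _ 2) => // e e0 _.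
  have [n [ne _]] := approx e e0.
  have -> : star z - z = star (z - y n) - (z - y n) by rewrite starB ystar opprB subrKA.
  apply: le_trans (ler_normB _ _) _; rewrite norm_star mulr_natl mulr2n.
  exact: lerD.
have zfix : f z = z.
  apply/eqP; rewrite -subr_eq0; apply/eqP.
  apply: (@small_eq0 _ _ (2^-1 * (2^-1 + `|z|) + 1)).
    by rewrite !addr_ge0 ?mulr_ge0 ?addr_ge0.
  move=> e e0 _; have [n [ne ne1]] := approx e e0.
  have -> : f z - z = (f z - f (y n)) - (z - y n.+1).
    by rewrite opprB (_ : y n.+1 = f (y n)) // subrKA.
  apply: le_trans (ler_normB _ _) _; rewrite mulrDl mul1r; apply: lerD => //.
  apply: le_trans (fdist _ _) _; rewrite -mulrA ler_wpM2l //.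
  by rewrite addrC ler_pM ?addr_ge0 // lerD2r.
exists (1 - z); first by rewrite starB star1 zstar.
have z2 : z + z = a + z * z.
  have := congr1 (fun w => (2 : R[i]) *: w) zfix; rewrite /f /= scalerA mulfV ?scale1r //.
  by rewrite scaler_nat mulr2n.
have -> : a = z + (z - z * z) by rewrite addrA z2 addrK.
by rewrite mulrBr mulr1 mulrBl mul1r [in RHS]opprD addrA.
Qed.

(** C 1 - b^* b = c^* c, written as an identity of sandwiched products since this
    is how it is applied to the kernel. The constant is chosen to make the
    norm of b^* b / C at most 1/4. *)
Lemma cstar_norm_bound b : exists2 C : R[i], 0 <= C &
  exists c, forall a d, C *: (star d * a) = star (b * d) * (b * a) + star (c * d) * (c * a).
Proof.
pose C := (2 * (`|b| + 1)) ^+ 2 : R[i].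
have b1 : 0 < `|b| + 1 by rewrite ltr_wpDl.
have C0 : 0 < C by rewrite exprn_gt0 // mulr_gt0.
exists C; first exact: ltW.
have [||c sc cc] := @cstar_sqrt_small (C^-1 *: (star b * b)).
- by rewrite starZ cstar_starM starK conj_Creal // ger0_real // invr_ge0 ltW.
- rewrite normrZ ger0_norm ?invr_ge0 ?(ltW C0) // mulrC ler_pdivrMr //.
  have -> : `|star b * b| = `|b| ^+ 2 by exact: cstar_norm_star.
  apply: (@le_trans _ _ ((`|b| + 1) ^+ 2)).
    by rewrite ler_pXn2r ?nnegrE ?(ltW b1) // lerDl.
  rewrite /C exprMn mulrA ler_peMl ?exprn_ge0 ?(ltW b1) //.
  have -> : 3 / 4 * 2 ^+ 2 = 1 + 2 :> R[i] by field.
  by rewrite lerDl.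
exists ((2 * (`|b| + 1)) *: c) => a d.
have rC : (2 * (`|b| + 1))^* = 2 * (`|b| + 1).
  by rewrite conj_Creal // ger0_real // mulr_ge0 // ltW.
rewrite !cstar_starM starZ rC sc.
have -> : star d * star b * (b * a) = C *: (star d * (C^-1 *: (star b * b)) * a).
  rewrite -!(cstar_scaleAr, cstar_scaleAl) scalerA mulfV ?gt_eqF // scale1r.
  by rewrite !mulrA.
have -> : star d * ((2 * (`|b| + 1)) *: c) * ((2 * (`|b| + 1)) *: c * a) =
    C *: (star d * (c * c) * a).
  by rewrite -!(cstar_scaleAr, cstar_scaleAl) scalerA -expr2 !mulrA.
by rewrite -scalerDr -mulrDl -mulrDr cc addrC subrK mulr1.
Qed.

End CStarFacts.

(** * The action and isometries *)

Section Action.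
Variables (R : realType) (P : monoidType) (A : cstarType R) (beta : P -> A -> A).
Hypothesis beta_act : action_by_automorphisms beta.
Implicit Types (p q : P) (a b : A).

Lemma betaK p : cancel (beta p) (inv_action beta p).
Proof.
have [aut _ _] := beta_act; have [[g gK Kg] _ _ _] := aut p.
move=> a; rewrite /inv_action; apply: pinvKV; rewrite ?in_setT //.
by move=> x y _ _; exact: can_inj gK x y.
Qed.

Lemma inv_actionK p : cancel (inv_action beta p) (beta p).
Proof.
have [aut _ _] := beta_act; have [[g gK Kg] _ _ _] := aut p.
by move=> a; rewrite -[a in LHS]Kg betaK Kg.
Qed.

Lemma inv_action_linear p : linear (inv_action beta p).
Proof.
have [aut _ _] := beta_act; have [_ bl _ _] := aut p.
move=> c a b; rewrite -[RHS](betaK p); congr inv_action.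
by rewrite bl !inv_actionK.
Qed.

Lemma inv_actionM p a b : inv_action beta p (a * b) = inv_action beta p a * inv_action beta p b.
Proof.
have [aut _ _] := beta_act; have [_ _ bM _] := aut p.
by rewrite -[RHS](betaK p) bM !inv_actionK.
Qed.

Lemma inv_action_star p a : inv_action beta p (star a) = star (inv_action beta p a).
Proof.
have [aut _ _] := beta_act; have [_ _ _ bs] := aut p.
by rewrite -[RHS](betaK p) bs inv_actionK.
Qed.

Lemma inv_action1 a : inv_action beta 1%g a = a.
Proof. by have [_ _ b1] := beta_act; rewrite -{2}(inv_actionK 1%g a) b1. Qed.

Lemma inv_actionMg p q a : inv_action beta (p * q)%g a = inv_action beta q (inv_action beta p a).
Proof.
have [_ bb _] := beta_act.
by rewrite -[RHS](betaK (p * q)%g) -bb /= !inv_actionK.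
Qed.

Lemma inv_action_one p : inv_action beta p 1 = 1.
Proof.
have := inv_actionM p 1 (beta p 1); rewrite mul1r betaK => e.
by rewrite [RHS]e mulr1.
Qed.

End Action.

Section Isometry.
Variables (R : realType) (H K : hilbertType R) (J : H -> K).

(** Polarization, comparing |x + c y|^2 for c = 1 and c = i. *)
Lemma isometry_dotp : linear J -> (forall x, `|J x| = `|x|) ->
  forall x y, dotp (J x) (J y) = dotp x y.
Proof.
move=> Jl Jn x y.
have E c : c^* * dotp (J x) (J y) + c * (dotp (J x) (J y))^* =
           c^* * dotp x y + c * (dotp x y)^*.
  have := Jn (x + c *: y); move/(congr1 (fun z => z ^+ 2)); rewrite !norm_dotp.
  rewrite (linD Jl) (linZ Jl) !dotpDl !dotpDr !dotpZl !dotpZr -!norm_dotp !Jn !norm_dotp.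
  rewrite (dotpC (J y) (J x)) (dotpC y x) => e.
  have := congr1 (fun z => z - (dotp x x + c * (c^* * dotp y y))) e.
  move=> {}e; transitivity (dotp x x + c^* * dotp (J x) (J y) +
    (c * (dotp (J x) (J y))^* + c * (c^* * dotp y y)) - (dotp x x + c * (c^* * dotp y y))).
    by ring.
  by rewrite e; ring.
move: (dotp (J x) (J y)) (dotp x y) E => s t E.
have := E 1; have := E 'i; rewrite conjC1 conjCi !mul1r => e2 e1.
have {}e2 : - s + s^* = - t + t^*.
  by apply: (@mulfI _ ('i : R[i])); rewrite ?neq0Ci // !mulrDr !mulrN -!mulNr.
have : 2 * s = 2 * t.
  transitivity ((s + s^*) - (- s + s^*)); first by ring.
  by rewrite e1 e2; ring.
by apply: mulfI; rewrite pnatr_eq0.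
Qed.

End Isometry.

(** * From a dilation to complete positivity *)

Lemma bounded_opB (R : realType) (H : hilbertType R) (S S' : H -> H) :
  bounded_op S -> bounded_op S' -> bounded_op (S - S').
Proof.
by move=> Sb S'b; rewrite -scaleN1r; apply: bounded_opD => //; exact: bounded_opZ.
Qed.

Section LcmFamily.
Variables (R : realType) (P : monoidType) (A : cstarType R) (beta : P -> A -> A).
Hypotheses (P_canc : cancellative P) (P_lcm : right_LCM P) (P_units : trivial_units P).
Hypothesis beta_act : action_by_automorphisms beta.
Variables (H : hilbertType R) (rho : A -> H -> H) (S : P -> H -> H).
Hypotheses (rho_bounded : forall a, bounded_op (rho a)) (rho_linear : linear rho).
Hypothesis (S_bounded : forall p, bounded_op (S p)).

Definition conj_opt (x : option P) (a : A) : H -> H :=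
  if x is Some s then conj_op beta rho S s a else 0.

Lemma conj_op_bounded p a : bounded_op (conj_op beta rho S p a).
Proof. by apply: comp_bounded; [apply: comp_bounded | apply: adj_bounded]. Qed.

Lemma conj_opt_bounded x a : bounded_op (conj_opt x a).
Proof. by case: x => [p|]; [exact: conj_op_bounded | exact: bounded_op0]. Qed.

Lemma conj_opt_linear x : linear (conj_opt x).
Proof.
case: x => [p|] c a b; last by rewrite /= scaler0 addr0.
apply/funext => h; rewrite /conj_opt /conj_op /= inv_action_linear // rho_linear.
by have [Sl _] := S_bounded p; rewrite !fctE Sl.
Qed.

Lemma altsum_bounded (f : option P -> H -> H) x l :
  (forall y, bounded_op (f y)) -> bounded_op (altsum f x l).
Proof.
move=> fb; elim: l x => [|p l IH] x /=; first exact: fb.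
by apply: bounded_opB; exact: IH.
Qed.

Lemma altsum_linear (f : option P -> A -> H -> H) x l :
  (forall y, linear (f y)) -> linear (fun a => altsum (f ^~ a) x l).
Proof.
move=> fl c a b; elim: l x => [|p l IH] x /=; first exact: fl.
by rewrite !IH scalerBr opprD addrACA.
Qed.

Lemma phi_FE F a :
  phi_F beta rho S F a = altsum (conj_opt ^~ a) (Some 1%g) (enum_fset F).
Proof.
rewrite -(sum_fpowerset P_canc P_lcm P_units (C := R[i])) /phi_F.
rewrite [X in _ = \sum_(_ <- fpowerset X) _](_ : _ = F); last by apply/fsetP => p; rewrite inE.
by apply: eq_bigr => U _; rewrite join1x.
Qed.

Lemma dotp_altsuml (f : option P -> H -> H) x l h h' :
  dotp (altsum f x l h) h' = altsum (fun y => dotp (f y h) h') x l.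
Proof.
rewrite (@altsum_morph _ _ _ (fun S : H -> H => dotp (S h) h')) // => S1 S2.
by rewrite !fctE dotpBl.
Qed.

End LcmFamily.

Section Necessity.
Variables (R : realType) (P : monoidType) (A : cstarType R) (beta : P -> A -> A).
Hypotheses (P_canc : cancellative P) (P_lcm : right_LCM P) (P_units : trivial_units P).
Hypothesis beta_act : action_by_automorphisms beta.
Variables (K : hilbertType R) (pi : A -> K -> K) (V : P -> K -> K).
Hypotheses (pi_hom : star_hom pi) (V_bounded : forall p, bounded_op (V p)).
Hypothesis V_cov : forall a b p q r,
  right_ideal p `&` right_ideal q = right_ideal r ->
  conj_op beta pi V p a \o conj_op beta pi V q b = conj_op beta pi V r (a * b).
Hypothesis V_orth : forall p q, right_ideal p `&` right_ideal q = set0 ->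
  forall x y, dotp (V p x) (V q y) = 0.

Local Notation E := (conj_opt beta pi V).

Let pi_bounded a : bounded_op (pi a). Proof. by case: pi_hom. Qed.
Let pi_linear : linear pi. Proof. by case: pi_hom. Qed.

(** The covariance relations together with the orthogonality of ranges: the
    products of the E_p follow the intersections of the right ideals. *)
Lemma conj_opt_join x y a b : E x a \o E y b = E (join x y) (a * b).
Proof.
have l0 (S : K -> K) : bounded_op S -> S 0 = 0 by case=> Sl _; exact: lin0.
have jP := joinP P_lcm x y.
case: x y jP => [p|] [q|] jP.
- case Ej: (join _ _) jP => [r|] /= jP; first by apply: V_cov; rewrite -jP.
  apply/funext => h; rewrite /conj_op /=.
  rewrite (_ : adj (V p) (V q _) = 0); first by rewrite !l0.
  by apply: dotp_extr => z; rewrite dotp0r -adjE // V_orth.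
- rewrite joinC // joinNx //; apply/funext => h /=.
  by rewrite l0 //; exact: conj_op_bounded.
- by rewrite joinNx.
- by rewrite joinNx.
Qed.

Lemma conj_opt_adj x a h h' : dotp (E x a h) h' = dotp h (E x (star a) h').
Proof.
case: x => [p|] /=; last by rewrite dotp0l dotp0r.
rewrite /conj_op /= adjE // adjE // inv_action_star //.
by have [_ _ _ ->] := pi_hom; rewrite [RHS]adjEr.
Qed.

Local Notation M x l a := (altsum (E ^~ a) x l).

Let M_bounded x l a : bounded_op (M x l a).
Proof. by apply: altsum_bounded => y; exact: conj_opt_bounded. Qed.

(** Of the four products in the induction step, the three that involve the new
    element are equal, since joins are idempotent; one of them survives. *)
Lemma altsum_conj_mul x y l a b : M x l a \o M y l b = M (join x y) l (a * b).
Proof.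
elim: l x y => [|p l IH] x y /=; first exact: conj_opt_join.
have {}IH u v z : M u l a (M v l b z) = M (join u v) l (a * b) z by rewrite -IH.
apply/funext => z /=; rewrite !fctE.
have [Ml _] := M_bounded x l a; have [M'l _] := M_bounded (join x (Some p)) l a.
rewrite (linB Ml) (linB M'l) !IH.
have -> : join x (join y (Some p)) = join (join x y) (Some p) by rewrite joinA.
have e2 : join (join x (Some p)) y = join (join x y) (Some p) by rewrite joinAC.
have -> : join (join x (Some p)) (join y (Some p)) = join (join x y) (Some p).
  by rewrite joinA // e2 -joinA // joinxx.
by rewrite e2 subrr subr0.
Qed.

Lemma altsum_conj_adj x l a h h' : dotp (M x l a h) h' = dotp h (M x l (star a) h').
Proof.
elim: l x => [|p l IH] x /=; first exact: conj_opt_adj.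
by rewrite !fctE dotpBl dotpBr !IH.
Qed.

(** M(b^* b) = M(b)^* M(b), entrywise, so the quadratic form is a sum of squares. *)
Lemma altsum_conj_pos l n (b : 'M[A]_n) (h : 'I_n -> K) :
  0 <= \sum_i \sum_j
    dotp (M (Some 1%g) l (((map_mx star b)^T *m b) i j) (h j)) (h i).
Proof.
have Ml : linear (fun a => M (Some 1%g) l a).
  by apply: altsum_linear => y; exact: conj_opt_linear.
have -> : \sum_i \sum_j dotp (M (Some 1%g) l (((map_mx star b)^T *m b) i j) (h j)) (h i) =
    \sum_k dotp (\sum_j M (Some 1%g) l (b k j) (h j)) (\sum_j M (Some 1%g) l (b k j) (h j)).
  transitivity (\sum_i \sum_j \sum_k
      dotp (M (Some 1%g) l (b k j) (h j)) (M (Some 1%g) l (b k i) (h i))).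
    apply: eq_bigr => i _; apply: eq_bigr => j _.
    rewrite mxE (lin_sum Ml) fct_sumE dotp_suml; apply: eq_bigr => k _.
    rewrite !mxE -{1}(joinxx P_canc P_lcm P_units (Some 1%g)) -altsum_conj_mul /=.
    by rewrite altsum_conj_adj starK.
  rewrite exchange_big /= [RHS](eq_bigr (fun k => \sum_j \sum_i
      dotp (M (Some 1%g) l (b k j) (h j)) (M (Some 1%g) l (b k i) (h i)))).
    rewrite [RHS]exchange_big; apply: eq_bigr => j _ /=.
    by rewrite exchange_big.
  by move=> k _; rewrite dotp_suml; apply: eq_bigr => j _; rewrite dotp_sumr.
by apply: sumr_ge0 => k _; exact: dotp_ge0.
Qed.

End Necessity.

(** Co-invariance gives V(p)^* J = J T(p)^* , hence J^* E_p(a) J = T(p)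
    phi(beta_p^-1(a)) T(p)^* for every p: phi_F is the compression of the
    alternating sum of the E_p. *)
Lemma dilation_phi_F_cp (R : realType) (P : monoidType)
    (P_canc : cancellative P) (P_lcm : right_LCM P) (P_units : trivial_units P)
    (A : cstarType R) (beta : P -> A -> A) (beta_act : action_by_automorphisms beta)
    (H : hilbertType R) (phi : A -> H -> H) (phi_cp : completely_positive phi)
    (T : P -> H -> H) (T_bounded : forall p, bounded_op (T p))
    (K : hilbertType R) (J : H -> K) (pi : A -> K -> K) (V : P -> K -> K) :
  inclusion J -> star_hom pi -> (forall p, bounded_op (V p)) ->
  (forall a b p q r, right_ideal p `&` right_ideal q = right_ideal r ->
     conj_op beta pi V p a \o conj_op beta pi V q b = conj_op beta pi V r (a * b)) ->
  (forall p q, right_ideal p `&` right_ideal q = set0 ->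
     forall x y, dotp (V p x) (V q y) = 0) ->
  (forall a, compresses J (pi a) (phi a)) ->
  (forall p, compresses J (V p) (T p)) ->
  (forall p, adj (V p) @` range J `<=` range J) ->
  forall F : {fset P}, completely_positive (phi_F beta phi T F).
Proof.
move=> [Jl Jn] pi_hom V_bounded V_cov V_orth pi_phi V_T V_co F.
have [phi_bounded phi_linear _] := phi_cp.
have JJ := isometry_dotp Jl Jn.
have FE := phi_FE beta P_canc P_lcm P_units phi T F.
have V_adjJ p h : adj (V p) (J h) = J (adj (T p) h).
  have [|g _ gE] := V_co p (adj (V p) (J h)); first by exists (J h) => //; exists h.
  rewrite -gE; congr J; apply: dotp_ext => w.
  rewrite -JJ gE -adjEr // -[RHS]adjEr // -JJ; apply/eqP; rewrite -subr_eq0 -dotpBr.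
  by rewrite dotpC (V_T p w h) conjC0.
have conjE x a h h' : dotp (conj_opt beta phi T x a h) h' =
    dotp (conj_opt beta pi V x a (J h)) (J h').
  case: x => [p|] /=; last by rewrite !dotp0l.
  rewrite /conj_op /= (adjE (T_bounded p)) (adjE (V_bounded p)) !V_adjJ.
  apply/eqP; rewrite -JJ eq_sym -subr_eq0 -dotpBl.
  by apply/eqP; exact: pi_phi.
split.
- by move=> a; rewrite FE; apply: altsum_bounded => y; exact: conj_opt_bounded.
- move=> c a b; rewrite !FE.
  by apply: altsum_linear => y; exact: conj_opt_linear.
- move=> n _ [b ->] h.
  have pi_b a : bounded_op (pi a) by case: pi_hom.
  apply: le_trans (altsum_conj_pos P_canc P_lcm P_units beta_act pi_hom V_bounded V_cov V_orth
    (enum_fset F) b (fun j => J (h j))) _.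
  rewrite le_eqVlt; apply/orP; left; apply/eqP.
  apply: eq_bigr => i _; apply: eq_bigr => j _.
  by rewrite FE !dotp_altsuml; apply: eq_altsum => y; rewrite conjE.
Qed.

(** * Positivity of the dilation kernel *)

Section Sufficiency.
Variables (R : realType) (P : monoidType) (A : cstarType R) (beta : P -> A -> A).
Hypotheses (P_canc : cancellative P) (P_lcm : right_LCM P) (P_units : trivial_units P).
Hypothesis beta_act : action_by_automorphisms beta.
Variables (H : hilbertType R) (phi : A -> H -> H) (T : P -> H -> H).
Hypothesis phi_bounded : forall a, bounded_op (phi a).
Hypothesis T_rep : representation T.
Hypothesis phi_F_cp : forall F : {fset P}, completely_positive (phi_F beta phi T F).

Let X := (P * A * H)%type.
Implicit Types (x y : X) (p q r s : P) (a b : A) (h : H) (m : option P) (l : seq P).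

Let T_bounded p : bounded_op (T p). Proof. by case: T_rep. Qed.
Let T1 : T 1%g = id. Proof. by case: T_rep. Qed.
Let TM p q : T (p * q)%g = T p \o T q. Proof. by case: T_rep. Qed.

Let adjT_mul p q h : adj (T (p * q)%g) h = adj (T q) (adj (T p) h).
Proof. by rewrite TM adj_comp. Qed.

Let adjT_linear p : linear (adj (T p)).
Proof. exact: adj_linear. Qed.

(** In a dilation this is < Q_m pi(a) V(p) h , pi(b) V(q) k > for x = (p, a, h),
    y = (q, b, k) and Q_m = V(m) V(m)^* . *)
Definition gram m x y : R[i] :=
  if join m (join (Some x.1.1) (Some y.1.1)) is Some r then
    dotp (phi (inv_action beta r (star y.1.2 * x.1.2)) (adj (T (ldiv x.1.1 r)) x.2))
         (adj (T (ldiv y.1.1 r)) y.2)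
  else 0.

Definition dilation_kernel x y : R[i] := gram (Some 1%g) x y.

Lemma gramN x y : gram None x y = 0.
Proof. by rewrite /gram joinNx. Qed.

Lemma gram_joinl m x y : gram (join m (Some x.1.1)) x y = gram m x y.
Proof. by rewrite /gram -joinA // (joinA _ _ _ (Some x.1.1) (Some x.1.1)) // joinxx. Qed.

Lemma gram_joinr m x y : gram (join m (Some y.1.1)) x y = gram m x y.
Proof. by rewrite /gram -joinA // (joinC _ _ _ (Some y.1.1)) // -joinA // joinxx. Qed.

(** Positivity of phi_F on the matrix with entries b_i^* b_j, which is B^* B for
    the square matrix B with first row b and zeros elsewhere. *)
Lemma altsum_phi_pos l n (b : 'I_n -> A) (h : 'I_n -> H) :
  0 <= \sum_i \sum_j
    dotp (altsum (fun m => conj_opt beta phi T m (star (b i) * b j)) (Some 1%g) l (h j)) (h i).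
Proof.
case: n b h => [|n] b h; first by rewrite big_ord0.
have [_ _ cp] := phi_F_cp [fset p in l]%fset.
pose B : 'M[A]_n.+1 := \matrix_(k, j) (if k == ord0 then b j else 0).
have := cp _ ((map_mx star B)^T *m B) (ex_intro _ B erefl) h.
congr (0 <= _); apply: eq_bigr => i _; apply: eq_bigr => j _; congr (dotp _ _).
rewrite mxE (bigD1 ord0) //= big1 ?addr0 => [|k /negPf k0]; last first.
  by rewrite !mxE k0 mulr0.
rewrite !mxE eqxx -(sum_fpowerset P_canc P_lcm P_units (C := R[i])) /phi_F; congr (_ (h j)).
by apply: eq_bigr => U _; rewrite join1x.
Qed.

Lemma altsum_phi_pos_seq (I : Type) (r : seq I) l (b : I -> A) (h : I -> H) :
  0 <= \sum_(v <- r) \sum_(u <- r)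
    dotp (altsum (fun m => conj_opt beta phi T m (star (b v) * b u)) (Some 1%g) l (h u)) (h v).
Proof.
have := altsum_phi_pos l (fun i => b (tnth (in_tuple r) i)) (fun i => h (tnth (in_tuple r) i)).
congr (0 <= _); rewrite [RHS]big_tnth; apply: eq_bigr => i _.
by rewrite [RHS]big_tnth.
Qed.

(** Once [s] lies in both ideals, the kernel restricted below [s] is the form of
    phi_G translated by [s], for G = [shift_back s l]. *)
Lemma altsum_gram_active s l x y :
  right_ideal x.1.1 s -> right_ideal y.1.1 s ->
  altsum (fun m => gram m x y) (Some s) l =
  dotp (altsum (fun m => conj_opt beta phi T m
         (star (inv_action beta s y.1.2) * inv_action beta s x.1.2)) (Some 1%g)
         (shift_back s l) (adj (T (ldiv x.1.1 s)) x.2)) (adj (T (ldiv y.1.1 s)) y.2).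
Proof.
move=> xs ys; rewrite -[s in Some s]mulg1 -[Some (s * 1)%g]/(shift s (Some 1%g)).
rewrite altsum_shift ?gramN // dotp_altsuml; apply: eq_altsum => -[m|] /=; last first.
  by rewrite dotp0l gramN.
have sub p : right_ideal p s -> ideal (Some (s * m)%g) `<=` ideal (Some p).
  move=> /right_idealP [u ->] _ /right_idealP [w ->]; apply/right_idealP.
  by exists (u * m * w)%g; rewrite !mulgA.
rewrite /gram join_l //; last by rewrite joinP // => z zs; split; exact: (sub _ _ _ zs).
rewrite !ldiv_mul // !adjT_mul inv_actionMg // inv_actionM // inv_action_star //.
by rewrite /conj_op /= [RHS]adjE.
Qed.

Definition gram_sum (xi : seq (R[i] * X)) m : R[i] :=
  \sum_(v <- xi) v.1^* * \sum_(u <- xi) u.1 * gram m u.2 v.2.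

Lemma altsumM (c : R[i]) (f : option P -> R[i]) m l :
  altsum (fun m => c * f m) m l = c * altsum f m l.
Proof. by elim: l m => //= p l IH m; rewrite !IH mulrBr. Qed.

Lemma altsum_gram_sum xi m l : altsum (gram_sum xi) m l =
  \sum_(v <- xi) v.1^* * \sum_(u <- xi) u.1 * altsum (fun m => gram m u.2 v.2) m l.
Proof.
rewrite /gram_sum altsum_sum; apply: eq_bigr => v _; rewrite altsumM altsum_sum; congr (_ * _).
by apply: eq_bigr => u _; rewrite altsumM.
Qed.

(** On a piece where every projection has been chosen or complemented, the
    vectors with complemented projection drop out by [altsum_absorb], and the
    others give a value of the form of phi_G. *)
Lemma gram_sum_decided xi s l :
  (forall u, u \in xi -> u.2.1.1 \in l \/ right_ideal u.2.1.1 s) ->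
  0 <= altsum (gram_sum xi) (Some s) l.
Proof.
move=> dec; rewrite altsum_gram_sum.
pose hh (u : R[i] * X) : H :=
  if `[< right_ideal u.2.1.1 s >] then u.1 *: adj (T (ldiv u.2.1.1 s)) u.2.2 else 0.
have := altsum_phi_pos_seq xi (shift_back s l) (fun u => inv_action beta s u.2.1.2) hh.
congr (0 <= _); apply: eq_big_seq => v vxi; rewrite mulr_sumr; apply: eq_big_seq => u uxi.
have Ml c : linear (altsum (fun m => conj_opt beta phi T m c) (Some 1%g) (shift_back s l)).
  by have [] : bounded_op (altsum (fun m => conj_opt beta phi T m c) (Some 1%g) (shift_back s l));
    [apply: altsum_bounded => y; exact: conj_opt_bounded|].
rewrite /hh; case: asboolP => us; last first.
  rewrite (lin0 (Ml _)) dotp0l.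
  have [ul|//] := dec _ uxi.
  rewrite -(altsum_join P_canc P_lcm P_units _ (z := Some u.2.1.1)); last first.
    by move=> y; exact: gram_joinl.
  rewrite (altsum_absorb P_canc P_lcm P_units _ ul) ?mulr0 //.
  by rewrite joinC //; exact: join_sub.
case: asboolP => vs; last first.
  rewrite dotp0r.
  have [vl|//] := dec _ vxi.
  rewrite -(altsum_join P_canc P_lcm P_units _ (z := Some v.2.1.1)); last first.
    by move=> y; exact: gram_joinr.
  rewrite (altsum_absorb P_canc P_lcm P_units _ vl) ?mulr0 //.
  by rewrite joinC //; exact: join_sub.
by rewrite (linZ (Ml _)) dotpZl dotpZr altsum_gram_active // mulrCA.
Qed.

(** Induction on the list [r] of points for which no choice has been made: the
    form is the sum of its restrictions to the range of the projection of [p]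
    and to the complement. *)
Lemma gram_sum_pos xi (r : seq P) m l :
  (forall u, u \in xi -> u.2.1.1 \in r \/ u.2.1.1 \in l \/ ideal m `<=` right_ideal u.2.1.1) ->
  0 <= altsum (gram_sum xi) m l.
Proof.
elim: r m l => [|p r IH] m l dec.
  case: m dec => [s|] dec; last first.
    rewrite altsum_None // /gram_sum big1 // => v _; rewrite big1 ?mulr0 // => u _.
    by rewrite gramN mulr0.
  apply: gram_sum_decided => u /dec [//|[ul|us]]; [by left|right].
  by apply: us; exact: right_ideal_refl.
have -> : altsum (gram_sum xi) m l =
    altsum (gram_sum xi) m (p :: l) + altsum (gram_sum xi) (join m (Some p)) l.
  by rewrite /= subrK.
apply: addr_ge0; apply: IH => u /dec.
  rewrite !inE => -[/orP[/eqP ->|ur]|[ul|um]];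
    [|by left|by right; left; rewrite ul orbT|by right; right].
  by right; left; rewrite eqxx.
rewrite inE => -[/orP[/eqP ->|ur]|[ul|um]]; [|by left|by right; left|right; right].
  by right; right; rewrite joinC //; exact: join_sub.
by apply: subset_trans um; exact: join_sub.
Qed.

Lemma dilation_kernel_positive : positive_kernel dilation_kernel.
Proof.
move=> xi; apply: (@gram_sum_pos xi [seq u.2.1.1 | u <- xi] (Some 1%g) [::]) => u uxi.
by left; apply/mapP; exists u.
Qed.

End Sufficiency.

(** * The dilation *)

Section Dilation.
Variables (R : realType) (P : monoidType) (A : cstarType R) (beta : P -> A -> A).
Hypotheses (P_canc : cancellative P) (P_lcm : right_LCM P) (P_units : trivial_units P).
Hypothesis beta_act : action_by_automorphisms beta.
Variables (H : hilbertType R) (phi : A -> H -> H) (T : P -> H -> H).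
Hypotheses (phi_bounded : forall a, bounded_op (phi a)) (phi_linear : linear phi).
Hypothesis phi_unital : phi 1 = id.
Hypothesis T_rep : representation T.
Hypothesis phi_F_cp : forall F : {fset P}, completely_positive (phi_F beta phi T F).

Local Notation X := (P * A * H)%type.
Implicit Types (x y : X) (p q r s : P) (a b : A) (h : H) (m : option P).

Let T_bounded p : bounded_op (T p). Proof. by case: T_rep. Qed.
Let T1 : T 1%g = id. Proof. by case: T_rep. Qed.
Let adjT1 h : adj (T 1%g) h = h. Proof. by rewrite T1 adj_id. Qed.
Let adjT_mul p q h : adj (T (p * q)%g) h = adj (T q) (adj (T p) h).
Proof. by have [_ _ ->] := T_rep; rewrite adj_comp. Qed.
Let adjT_linear p : linear (adj (T p)).
Proof. exact: adj_linear. Qed.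
Let adjT0 p : adj (T p) 0 = 0.
Proof. exact: lin0. Qed.

Local Notation k := (dilation_kernel beta phi T).
Let kP : positive_kernel k :=
  dilation_kernel_positive P_canc P_lcm P_units beta_act phi_bounded T_rep phi_F_cp.

Let kE x y : k x y =
  if join (Some x.1.1) (Some y.1.1) is Some r then
    dotp (phi (inv_action beta r (star y.1.2 * x.1.2)) (adj (T (ldiv x.1.1 r)) x.2))
         (adj (T (ldiv y.1.1 r)) y.2)
  else 0.
Proof. by rewrite /dilation_kernel /gram join1x. Qed.

Lemma dilation_kernel_linear_h p a (c : R[i]) h h' :
  k (p, a, c *: h + h') = c *: k (p, a, h) + k (p, a, h').
Proof.
apply/funext => y; rewrite !fctE !kE /=; case: join => [r|]; last by rewrite scaler0 addr0.
have [fl _] := phi_bounded (inv_action beta r (star y.1.2 * a)).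
by rewrite adjT_linear fl dotpDl dotpZl.
Qed.

Lemma dilation_kernel_linear_a p a b (c : R[i]) h :
  k (p, c *: a + b, h) = c *: k (p, a, h) + k (p, b, h).
Proof.
apply/funext => y; rewrite !fctE !kE /=; case: join => [r|]; last by rewrite scaler0 addr0.
rewrite mulrDr -cstar_scaleAr inv_action_linear // phi_linear !fctE dotpDl dotpZl.
by [].
Qed.

(** The maps of P x A x H behind the operators on the vectors pi(a) V(q) h: left
    multiplication for pi(b), [push] for V(p), and [pull] for V(p)^* . When pP
    and qP are disjoint V(p)^* kills the vector, and [pull] returns a triple with
    third component 0, which represents the vector 0. *)
Definition left_mul b x : X := (x.1.1, b * x.1.2, x.2).
Definition push p x : X := ((p * x.1.1)%g, beta p x.1.2, x.2).
Definition pull p x : X :=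
  if join (Some p) (Some x.1.1) is Some r then
    (ldiv p r, inv_action beta p x.1.2, adj (T (ldiv x.1.1 r)) x.2)
  else (1%g, 1, 0).

Lemma left_mul_adjoint b : kernel_adjoint k (left_mul b) (left_mul (star b)).
Proof. by move=> x y; rewrite !kE /= cstar_starM starK mulrA. Qed.

(** C <x, x> - <b x, b x> = <c x, c x> >= 0. *)
Lemma left_mul_bounded b : kernel_bounded k (left_mul b).
Proof.
have [C C0 [c bc]] := cstar_norm_bound b.
have E xi d : pairing (comb k (map_vec (left_mul d) xi)) (map_vec (left_mul d) xi) =
    \sum_(v <- xi) v.1^* * \sum_(u <- xi) u.1 * k (left_mul d u.2) (left_mul d v.2).
  rewrite /pairing /comb /map_vec !big_map; apply: eq_bigr => v _ /=.
  by rewrite big_map.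
exists (sqrtC C) => [|xi]; first by rewrite sqrtC_ge0.
rewrite sqrtCK -subr_ge0; have := kP (map_vec (left_mul c) xi).
congr (0 <= _); apply/eqP; rewrite eq_sym subr_eq; apply/eqP; rewrite !E /pairing /comb.
rewrite mulr_sumr -big_split; apply: eq_bigr => v _ /=.
rewrite !mulr_sumr -big_split; apply: eq_bigr => u _ /=.
have kk : k (left_mul c u.2) (left_mul c v.2) + k (left_mul b u.2) (left_mul b v.2) = C * k u.2 v.2.
  rewrite !kE /=; case: join => [r|]; last by rewrite mulr0 addr0.
  rewrite -dotpZl -dotpDl; congr (dotp _ _).
  have e (S S' : H -> H) z : S z + S' z = (S + S') z by [].
  have e2 (S : H -> H) z : C *: S z = (C *: S) z by [].
  rewrite e e2 -(linD phi_linear) -(linZ phi_linear); congr (phi _ _).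
  rewrite -(linD (inv_action_linear beta_act r)) -(linZ (inv_action_linear beta_act r)).
  by congr inv_action; rewrite bc addrC.
by rewrite -!mulrDr kk; ring.
Qed.

(** With r = lcm(p, s) = p r' and n = lcm(q, r'), one has lcm(p q, s) = p n; both
    sides are computed at this common multiple. *)
Lemma push_adjoint p : kernel_adjoint k (push p) (pull p).
Proof.
move=> x y; rewrite !kE /= /pull.
have -> : join (Some (p * x.1.1)%g) (Some y.1.1) =
    join (shift p (Some x.1.1)) (join (Some p) (Some y.1.1)).
  rewrite joinA // (join_l P_canc P_lcm P_units (y := Some p)) //.
  exact: (@shift_sub _ p (Some _)).
case E: (join (Some p) (Some y.1.1)) => [r|]; last first.
  rewrite joinC // joinNx //=; case: join => // s; by rewrite adjT0 dotp0r.
have [pr yr] := join_some P_lcm E.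
have -> : Some r = shift p (Some (ldiv p r)) by rewrite /= mul_ldiv.
rewrite join_shift //=.
case E2: (join (Some x.1.1) (Some (ldiv p r))) => [n|] //=.
have [xn rn] := join_some P_lcm E2.
have -> : ldiv (p * x.1.1)%g (p * n)%g = ldiv x.1.1 n.
  by rewrite -{1}(mul_ldiv P_canc xn) mulgA ldivK.
have -> : ldiv y.1.1 (p * n)%g = (ldiv y.1.1 r * ldiv (ldiv p r) n)%g.
  by rewrite -ldiv_mul // -{1}(mul_ldiv P_canc rn) mulgA (mul_ldiv P_canc pr).
rewrite adjT_mul inv_actionMg // (inv_actionM beta_act p) inv_action_star //.
by rewrite betaK.
Qed.

Lemma pullK p x : pull p (push p x) = x.
Proof.
rewrite /pull /= joinC // (join_l P_canc P_lcm P_units (y := Some p)); last first.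
  exact: (@shift_sub _ p (Some _)).
by rewrite ldivK // ldivv // adjT1 betaK //; case: x => [[]].
Qed.

Lemma push_bounded p : kernel_bounded k (push p).
Proof.
exists 1 => // xi; rewrite expr1n mul1r (comb_map _ (push_adjoint p)) pairing_map.
rewrite (_ : _ \o _ = comb k xi) //; apply/funext => x /=.
by rewrite pullK.
Qed.

Local Notation K := (kernel_space kP).
Implicit Types f g : K.
Local Notation vec := (kernel_vec kP).

Lemma kernel_val_a p a b (c : R[i]) h f :
  kernel_val f (p, c *: a + b, h) = c^* * kernel_val f (p, a, h) + kernel_val f (p, b, h).
Proof.
rewrite -!dotp_kernel_vec -dotpZr -dotpDr; congr (dotp _ _).
by apply/val_inj; exact: dilation_kernel_linear_a.
Qed.

Lemma kernel_val0 p a f : kernel_val f (p, a, 0) = 0.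
Proof.
rewrite -dotp_kernel_vec (_ : vec _ = 0) ?dotp0r //; apply: kernel_space_ext => y.
rewrite kernel_vecE kE /=; case: join => [r|] //.
have [fl _] := phi_bounded (inv_action beta r (star y.1.2 * a)).
by rewrite adjT0 (lin0 fl) dotp0l.
Qed.

(** Operators act on functions by composition with the map of their adjoint. *)
Definition dil_pi b : K -> K := comp_op (kP := kP) (left_mul (star b)).
Definition dil_V p : K -> K := comp_op (kP := kP) (pull p).
Definition dil_J h : K := vec (1%g, 1, h).

Lemma dil_piE b f x : kernel_val (dil_pi b f) x = kernel_val f (left_mul (star b) x).
Proof.
by rewrite /dil_pi (comp_opE (left_mul_adjoint b)) //; exact: left_mul_bounded.
Qed.

Lemma dil_pi_bounded b : bounded_op (dil_pi b).
Proof. exact: comp_op_bounded (left_mul_adjoint b) (left_mul_bounded b). Qed.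

Lemma dil_VE p f x : kernel_val (dil_V p f) x = kernel_val f (pull p x).
Proof. by rewrite /dil_V (comp_opE (push_adjoint p)) //; exact: push_bounded. Qed.

Lemma dil_V_bounded p : bounded_op (dil_V p).
Proof. exact: comp_op_bounded (push_adjoint p) (push_bounded p). Qed.

Lemma dil_V_adjE p f x : kernel_val (adj (dil_V p) f) x = kernel_val f (push p x).
Proof. by rewrite (comp_op_adj (push_adjoint p)) //; exact: push_bounded. Qed.

Lemma dil_pi_star_hom : star_hom dil_pi.
Proof.
split.
- exact: dil_pi_bounded.
- move=> c a b; apply/funext => f; apply: kernel_space_ext => x.
  rewrite !fctE kernel_valD kernel_valZ !fctE !dil_piE /left_mul starD starZ mulrDl.
  by rewrite -cstar_scaleAl kernel_val_a conjCK.
- move=> a b; apply/funext => f; apply: kernel_space_ext => x /=.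
  by rewrite !dil_piE /left_mul /= cstar_starM mulrA.
- move=> a; apply/funext => f; apply: kernel_space_ext => x.
  rewrite dil_piE starK /dil_pi (comp_op_adj (left_mul_adjoint a)) //.
  exact: left_mul_bounded.
Qed.

Lemma dil_V_isometric : isometric_representation dil_V.
Proof.
split; [split|].
- exact: dil_V_bounded.
- apply/funext => f; apply: kernel_space_ext => x; rewrite dil_VE /pull join1x //.
  rewrite (_ : ldiv 1%g x.1.1 = x.1.1); last by rewrite -{1}(mul1g x.1.1) ldivK.
  by rewrite inv_action1 // ldivv // adjT1; case: x => [[]].
- move=> p q; rewrite -[LHS]adjK; last exact: dil_V_bounded.
  rewrite -[RHS]adjK; last by apply: comp_bounded; exact: dil_V_bounded.
  congr adj; rewrite adj_comp; [|exact: dil_V_bounded..].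
  apply/funext => f; apply: kernel_space_ext => x /=.
  rewrite !dil_V_adjE /push /= mulgA.
  by have [_ <- _] := beta_act.
- move=> p f; apply/eqP; rewrite -(@eqrXn2 _ 2) // !norm_dotp; apply/eqP.
  rewrite adjE; last exact: dil_V_bounded.
  congr (dotp _ _); apply: kernel_space_ext => x.
  by rewrite dil_V_adjE dil_VE pullK.
Qed.

(** The covariance relation can be read off from this formula, because joins are
    associative and the quotients compose. *)
Lemma dil_conjE p a f y : kernel_val (conj_op beta dil_pi dil_V p a f) y =
  if join (Some p) (Some y.1.1) is Some r then
    kernel_val f (r, star a * y.1.2, adj (T (ldiv y.1.1 r)) y.2)
  else 0.
Proof.
rewrite /conj_op /= dil_VE dil_piE dil_V_adjE /pull.
case E: join => [r|]; last by rewrite /push /left_mul /= kernel_val0.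
have [pr _] := join_some P_lcm E.
rewrite /push /left_mul /= mul_ldiv //; have [aut _ _] := beta_act.
have [_ _ bM bs] := aut p; by rewrite bM bs !inv_actionK.
Qed.

Lemma dil_covariant a b p q r : right_ideal p `&` right_ideal q = right_ideal r ->
  conj_op beta dil_pi dil_V p a \o conj_op beta dil_pi dil_V q b =
  conj_op beta dil_pi dil_V r (a * b).
Proof.
move=> pqr; have Er : join (Some p) (Some q) = Some r by apply: join_unique.
apply/funext => f; apply: kernel_space_ext => y /=; rewrite !dil_conjE -Er.
rewrite (joinC P_canc P_lcm P_units (Some p) (Some q)) -joinA //.
case E: (join (Some p) (Some y.1.1)) => [s|]; last by rewrite joinC // joinNx.
rewrite dil_conjE /=; case E2: (join (Some q) (Some s)) => [t|] //.
have [_ ys] := join_some P_lcm E; have [_ st] := join_some P_lcm E2.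
have -> : ldiv y.1.1 t = (ldiv y.1.1 s * ldiv s t)%g by rewrite -ldiv_mul // mul_ldiv.
rewrite adjT_mul.
by rewrite cstar_starM mulrA.
Qed.

Lemma dil_orthogonal p q : right_ideal p `&` right_ideal q = set0 ->
  forall f g, dotp (dil_V p f) (dil_V q g) = 0.
Proof.
move=> pq0 f g; rewrite adjE; last exact: dil_V_bounded.
rewrite (_ : adj _ _ = 0) ?dotp0r //; apply: kernel_space_ext => x.
rewrite dil_V_adjE dil_VE /pull /=.
rewrite (_ : join _ _ = None) ?kernel_val0 //.
apply: join_unique => //; apply/esym; rewrite -[LHS]/(right_ideal q `&` right_ideal (p * x.1.1)%g).
rewrite -subset0 => z [qz pxz].
rewrite -pq0; split=> //; move: pxz => /= /right_idealP [u ->].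
by apply/right_idealP; exists (x.1.1 * u)%g; rewrite mulgA.
Qed.

Lemma dil_J_dotp f h : dotp f (dil_J h) = kernel_val f (1%g, 1, h).
Proof. exact: dotp_kernel_vec. Qed.

Lemma kernel_J h h' a : k (1%g, a, h) (1%g, 1, h') = dotp (phi a h) h'.
Proof.
rewrite kE /= joinxx // ldivv // !adjT1 inv_action1 //.
by rewrite star1 mul1r.
Qed.

Lemma dil_J_inclusion : inclusion dil_J.
Proof.
split=> [c h h'|h].
  by apply/val_inj; exact: dilation_kernel_linear_h.
apply/eqP; rewrite -(@eqrXn2 _ 2) // !norm_dotp dil_J_dotp kernel_vecE kernel_J.
by rewrite phi_unital.
Qed.

Lemma dil_pi_compresses a : compresses dil_J (dil_pi a) (phi a).
Proof.
move=> h z; rewrite dotpBl !dil_J_dotp dil_piE !kernel_vecE /left_mul /= kernel_J.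
rewrite -[(_, _ * _, _)]/(left_mul (star a) (1%g, 1, z)) -left_mul_adjoint /left_mul /=.
by rewrite kernel_J mulr1 phi_unital subrr.
Qed.

Lemma dil_V_adjJ p h : adj (dil_V p) (dil_J h) = dil_J (adj (T p) h).
Proof.
apply: kernel_space_ext => x; rewrite dil_V_adjE !kernel_vecE.
rewrite -(kernel_adjointC kP (push_adjoint p)); congr (k _ _).
rewrite /pull /= joinC // join1x // ldivv // inv_action_one //.
by rewrite (_ : ldiv 1%g p = p) // -{1}(mul1g p) ldivK.
Qed.

Lemma dil_V_compresses p : compresses dil_J (dil_V p) (T p).
Proof.
move=> h z; have [Jl Jn] := dil_J_inclusion.
rewrite dotpBl adjE; last exact: dil_V_bounded.
by rewrite dil_V_adjJ !isometry_dotp // adjE // subrr.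
Qed.

Lemma dil_coinvariant p : adj (dil_V p) @` range dil_J `<=` range dil_J.
Proof. by move=> _ [_ [h _ <-] <-]; rewrite dil_V_adjJ; exists (adj (T p) h). Qed.

Theorem dilation_exists :
  exists (K : hilbertType R) (J : H -> K) (pi : A -> K -> K) (V : P -> K -> K),
    [/\ inclusion J, star_hom pi, isometric_representation V &
      [/\ (forall a b p q r,
             right_ideal p `&` right_ideal q = right_ideal r ->
             conj_op beta pi V p a \o conj_op beta pi V q b
               = conj_op beta pi V r (a * b)),
          (forall p q, right_ideal p `&` right_ideal q = set0 ->
             forall u v, dotp (V p u) (V q v) = 0),
          (forall a, compresses J (pi a) (phi a)),
          (forall p, compresses J (V p) (T p)) &
          (forall p, adj (V p) @` range J `<=` range J)]].
Proof.
exists (kernel_space kP), dil_J, dil_pi, dil_V.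
split; [exact: dil_J_inclusion | exact: dil_pi_star_hom | exact: dil_V_isometric | ].
split; [exact: dil_covariant | exact: dil_orthogonal | exact: dil_pi_compresses
  | exact: dil_V_compresses | exact: dil_coinvariant].
Qed.

End Dilation.

Theorem theorem7p3 (R : realType) (P : monoidType)
    (P_canc : cancellative P) (P_lcm : right_LCM P)
    (P_units : trivial_units P)
    (A : cstarType R) (beta : P -> A -> A)
    (beta_act : action_by_automorphisms beta)
    (H : hilbertType R)
    (phi : A -> H -> H) (phi_cp : completely_positive phi)
    (phi_unital : phi 1 = id)
    (T : P -> H -> H) (T_rep : contractive_representation T) :
  (exists (K : hilbertType R) (J : H -> K) (pi : A -> K -> K) (V : P -> K -> K),
    [/\ inclusion J, star_hom pi, isometric_representation V &
      [/\ (forall a b p q r,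
             right_ideal p `&` right_ideal q = right_ideal r ->
             conj_op beta pi V p a \o conj_op beta pi V q b
               = conj_op beta pi V r (a * b)),
          (forall p q, right_ideal p `&` right_ideal q = set0 ->
             forall x y, dotp (V p x) (V q y) = 0),
          (forall a, compresses J (pi a) (phi a)),
          (forall p, compresses J (V p) (T p)) &
          (forall p, adj (V p) @` range J `<=` range J)]])
  <->
  (forall F : {fset P}, completely_positive (phi_F beta phi T F)).
Proof.
have [phi_bounded phi_linear _] := phi_cp; have [T_repr _] := T_rep.
split=> [[K [J [pi [V [JJ pi_hom [[V_bounded _ _] _] [cov orth pi_phi V_T co]]]]]]|cp].
  have [T_bounded _ _] := T_repr.
  exact: (dilation_phi_F_cp P_canc P_lcm P_units beta_act phi_cp T_bounded JJ
    pi_hom V_bounded cov orth pi_phi V_T co).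
exact: (dilation_exists P_canc P_lcm P_units beta_act phi_bounded phi_linear
  phi_unital T_repr cp).
Qed.
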